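(* Let $f,g:(0,\infty)\to(0,\infty)$ be continuous functions that are exponentially bounded at $\infty$, i.e. $\log^+ f(t)=O(t)$ and $\log^+ g(t)=O(t)$ as $t\to\infty$. Suppose $u(x)$ and $v(x)$ are $C^2$ positive solutions of the system $$0\le -\Delta u\le f(v),\qquad 0\le -\Delta v\le g(u)$$ in a punctured neighborhood of the origin in $\mathbb{R}^2$. Then $$u(x)=O\left(\log\frac{1}{|x|}\right)\quad\text{and}\quad v(x)=O\left(\log\frac{1}{|x|}\right)\quad\text{as }x\to 0.$$
   Context: $\log^+ s:=\log s$ if $s>1$ and $\log^+ s:=0$ if $s\le 1$. A continuous function $f:(0,\infty)\to(0,\infty)$ is called exponentially bounded at $\infty$ if $\log^+ f(t)=O(t)$ as $t\to\infty$. *)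

(* Defs.v *)
From Stdlib Require Import Reals.
From Coquelicot Require Import Coquelicot.
Open Scope R_scope.

Definition log_plus (s : R) : R := if Rlt_dec 1 s then ln s else 0.

Definition is_bigO {T : Type} (F : (T -> Prop) -> Prop) (f g : T -> R) : Prop :=
  exists C : R, F (fun x => Rabs (f x) <= C * Rabs (g x)).

(* A function f : (0,oo) -> (0,oo) is represented by a total f : R -> R whose
   values outside (0,oo) are irrelevant; as (0,oo) is open, continuity of the
   former amounts to [continuous f t] at every t > 0. *)
Definition continuous_pos_fun (f : R -> R) : Prop :=
  forall t : R, 0 < t -> 0 < f t /\ continuous f t.

Definition exp_bounded_at_infinity (f : R -> R) : Prop :=
  is_bigO (Rbar_locally p_infty) (fun t => log_plus (f t)) (fun t => t).

Definition euclidean_norm (x : R * R) : R := sqrt (fst x ^ 2 + snd x ^ 2).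

Definition laplacian (u : R -> R -> R) (x : R * R) : R :=
  partial_derive 2 0 u (fst x) (snd x) + partial_derive 0 2 u (fst x) (snd x).

(* [ex_diff_n u 2] asks, at a point, that u and its partial derivatives of order
   at most 2 exist and be continuous; required at every point of an open set it
   says that u is C^2 there. [locally' (0, 0)] is the filter of punctured
   neighbourhoods of the origin, so the property below holds on some punctured
   open disc. *)
Definition C2_near_origin (u : R -> R -> R) : Prop :=
  locally' (0, 0) (fun x : R * R => ex_diff_n u 2 (fst x) (snd x)).

Definition positive_near_origin (u : R -> R -> R) : Prop :=
  locally' (0, 0) (fun x : R * R => 0 < u (fst x) (snd x)).

Definition solves_near_origin (f g : R -> R) (u v : R -> R -> R) : Prop :=
  locally' (0, 0) (fun x : R * R =>
    0 <= - laplacian u x <= f (v (fst x) (snd x)) /\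
    0 <= - laplacian v x <= g (u (fst x) (snd x))).

Definition bigO_log_at_origin (u : R -> R -> R) : Prop :=
  is_bigO (locally' (0, 0)) (fun x : R * R => u (fst x) (snd x))
          (fun x : R * R => ln (1 / euclidean_norm x)).

(* Main.v *)
Require Import Defs.
From Stdlib Require Import Reals Lra Psatz ClassicalEpsilon Classical.
From Coquelicot Require Import Coquelicot.
Open Scope R_scope.

(** Both [u] and [v] are positive and superharmonic near the origin, so they stay
    above a positive constant there ([positive_superharmonic_bounded_below]); then
    continuity and exponential growth give [f (v) <= K e^(K v)] and
    [g (u) <= K e^(K u)] ([exponential_bound_away_from_0]). Hence [w = u + v] satisfies the scalar inequality
    [0 <= - Lap w <= K e^(K w)] with [w > 0], and it is enough to bound [w].

    In the coordinates [x = e^(-t) (cos th, sin th)], [t = ln (1 / |x|)], the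
    Laplacian is only multiplied by [e^(-2t) <= 1] ([log_polar_C2]), so [w]
    becomes a function [V] on the half-cylinder [t > T], [2 PI]-periodic in [th],
    with [0 <= - Lap V <= K e^(K V)], and the claim is [V = O(t)]
    ([cylinder_linear_bound]).

    The circle averages of [V] are concave in [t] and nonnegative, so their slope
    is nonnegative and decreases to a limit. This gives two facts: the averages
    grow at most linearly, and the mass of [- Lap V] over slabs of bounded width
    tends to [0] ([circ_linear_growth], [source_mass_vanishes]).

    The passage from averages to values rests on Green's identity on a square with
    a truncated and smoothed logarithm as test function. It gives two estimates for
    a nonnegative superharmonic [V]: the average over a square of half-side [del] is
    at most a constant times the average over the concentric one of half-side 1 plus
    [ln (1 / del^2)] times the mass ([small_square_average_le_mass]); and if
    [- Lap V <= A] on a square of half-side [tau], then the value at the centre is at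
    most a constant times the average plus [A tau^2]
    ([center_value_le_square_average]).

    To use them, let [p] be a point far out on the cylinder, [d] the distance to
    the boundary of the square of half-side 1 about [p], and [M] the value of [V]
    at a point where [d^2 e^(K V)] is maximal; then [V p <= M]. Near this point
    [- Lap V <= 4 K e^(K M)], so the second estimate applies at the scale
    [tau ~ e^(-K M / 2)], and the first one with [del = tau] produces a logarithm
    of size [K M] multiplied by a mass as small as desired. That term is absorbed
    in the left-hand side, which leaves [M <= C (average of V) + C = O(t)]. *)

(** * Continuous functions on a half-plane *)

(** Continuity is required on a half-plane, rather than on the rectangle of
    integration, so that partial integrals are defined and continuous at the end
    points as well. *)
Definition continuous_beyond (T : R) (F : R -> R -> R) : Prop :=
  forall x y, T < x -> continuity_2d_pt F x y.

Lemma continuity_2d_pt_snd F x y :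
  continuity_2d_pt F x y -> continuous (F x) y.
Proof.
  intros H. apply continuity_2d_pt_filterlim in H.
  apply (continuous_comp_2 (fun _ : R => x) (fun t : R => t) F).
  - apply continuous_const.
  - apply continuous_id.
  - exact H.
Qed.

Lemma continuity_2d_pt_fst F x y :
  continuity_2d_pt F x y -> continuous (fun t => F t y) x.
Proof.
  intros H. apply continuity_2d_pt_filterlim in H.
  apply (continuous_comp_2 (fun t : R => t) (fun _ : R => y) F).
  - apply continuous_id.
  - apply continuous_const.
  - exact H.
Qed.

Lemma continuity_2d_pt_comp_continuous (phi : R -> R) G x y :
  continuous phi (G x y) -> continuity_2d_pt G x y ->
  continuity_2d_pt (fun u v => phi (G u v)) x y.
Proof.
  intros H1 H2. apply continuity_1d_2d_pt_comp; [|exact H2].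
  apply continuity_pt_filterlim. exact H1.
Qed.

Lemma continuity_2d_pt_swap F x y :
  continuity_2d_pt F x y -> continuity_2d_pt (fun u v => F v u) y x.
Proof.
  intros H eps. destruct (H eps) as [d Hd]. exists d. intros u v Hu Hv.
  apply Hd; assumption.
Qed.

Lemma continuous_beyond_ex_RInt T F x c d :
  continuous_beyond T F -> T < x -> ex_RInt (F x) c d.
Proof.
  intros H Hx. apply (ex_RInt_continuous (V := R_CompleteNormedModule)).
  intros z _. apply continuity_2d_pt_snd, H, Hx.
Qed.

(** The integrability hypothesis covers the neighbours of [x]: continuity of [F]
    on the segment [{x} * [c, d]] says nothing about them. *)
Lemma continuous_RInt_param F c d x :
  c <= d -> (forall y, c <= y <= d -> continuity_2d_pt F x y) ->
  (locally x (fun t => ex_RInt (F t) c d)) ->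
  continuous (fun t => RInt (F t) c d) x.
Proof.
  intros Hcd HF Hex.
  apply filterlim_locally. intros eps.
  assert (He : 0 < eps / (d - c + 1)).
  { apply Rdiv_lt_0_compat; [apply cond_pos|lra]. }
  destruct (uniform_continuity_2d_1d' F c d x HF (mkposreal _ He)) as [del Hdel].
  simpl in Hdel.
  assert (Hx := locally_singleton _ _ Hex).
  destruct Hex as [d' Hex].
  assert (Hm : 0 < Rmin del d') by (apply Rmin_pos; apply cond_pos).
  exists (mkposreal _ Hm). intros t Ht.
  change (Rabs (t - x) < Rmin del d') in Ht.
  assert (Ht1 := Rlt_le_trans _ _ _ Ht (Rmin_l _ _)).
  assert (Ht2 := Rlt_le_trans _ _ _ Ht (Rmin_r _ _)).
  assert (Hext : ex_RInt (F t) c d) by (apply Hex; exact Ht2).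
  change (Rabs (RInt (F t) c d - RInt (F x) c d) < eps).
  change (RInt (F t) c d - RInt (F x) c d)
    with (minus (RInt (F t) c d) (RInt (F x) c d)).
  rewrite <- (RInt_minus (V := R_CompleteNormedModule)) by assumption.
  eapply Rle_lt_trans.
  - apply (abs_RInt_le_const _ _ _ (eps / (d - c + 1))); [exact Hcd| |].
    + apply (ex_RInt_minus (V := R_NormedModule)); assumption.
    + intros y Hy. apply Rlt_le.
      change (Rabs (F t y - F x y) < eps / (d - c + 1)).
      apply Rabs_def2 in Ht1.
      apply Hdel; try lra.
      replace (y - y) with 0 by ring. rewrite Rabs_R0. apply cond_pos.
  - assert (0 < eps) by apply cond_pos.
    apply Rlt_le_trans with ((d - c + 1) * (eps / (d - c + 1))).
    + apply Rmult_lt_compat_r; lra.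
    + right. field. lra.
Qed.

Lemma locally_gt T x : T < x -> locally x (fun t => T < t).
Proof. intros H. apply (open_gt T x H). Qed.

Lemma continuous_beyond_RInt T F c d x :
  c <= d -> continuous_beyond T F -> T < x ->
  continuous (fun t => RInt (F t) c d) x.
Proof.
  intros Hcd HF Hx. apply continuous_RInt_param; [exact Hcd| |].
  - intros y _. apply HF, Hx.
  - apply (filter_imp (fun t => T < t)); [|apply locally_gt, Hx].
    intros t Ht. apply (continuous_beyond_ex_RInt T); assumption.
Qed.

(** * Iterated integrals over rectangles *)

Definition DInt (a b c d : R) (F : R -> R -> R) : R :=
  RInt (fun x => RInt (F x) c d) a b.

Section DoubleIntegral.
Variables T a b c d : R.
Hypotheses (Ta : T < a) (ab : a <= b) (cd : c <= d).

Lemma continuous_beyond_ex_DInt F a' b' :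
  T < a' -> a' <= b' ->
  continuous_beyond T F -> ex_RInt (fun x => RInt (F x) c d) a' b'.
Proof.
  intros Ha' Hab' HF. apply (ex_RInt_continuous (V := R_CompleteNormedModule)).
  intros z Hz. rewrite Rmin_left in Hz by exact Hab'.
  apply (continuous_beyond_RInt T); [exact cd|exact HF|lra].
Qed.

Lemma DInt_plus F G :
  continuous_beyond T F -> continuous_beyond T G ->
  DInt a b c d (fun x y => F x y + G x y) = DInt a b c d F + DInt a b c d G.
Proof.
  intros HF HG. unfold DInt.
  rewrite <- (RInt_plus (V := R_CompleteNormedModule)) by (apply continuous_beyond_ex_DInt; assumption).
  apply RInt_ext. intros x Hx. rewrite Rmin_left in Hx by exact ab.
  apply (RInt_plus (V := R_CompleteNormedModule)); apply (continuous_beyond_ex_RInt T); try assumption; lra.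
Qed.

Lemma DInt_scal k F :
  continuous_beyond T F ->
  DInt a b c d (fun x y => k * F x y) = k * DInt a b c d F.
Proof.
  intros HF. unfold DInt.
  change (k * RInt (fun x => RInt (F x) c d) a b)
    with (scal k (RInt (fun x => RInt (F x) c d) a b)).
  rewrite <- (RInt_scal (V := R_CompleteNormedModule)) by (apply continuous_beyond_ex_DInt; assumption).
  apply RInt_ext. intros x Hx. rewrite Rmin_left in Hx by exact ab.
  apply (RInt_scal (V := R_CompleteNormedModule)); apply (continuous_beyond_ex_RInt T); try assumption; lra.
Qed.

Lemma DInt_le F G :
  continuous_beyond T F -> continuous_beyond T G ->
  (forall x y, a < x < b -> c < y < d -> F x y <= G x y) ->
  DInt a b c d F <= DInt a b c d G.
Proof.
  intros HF HG H. apply RInt_le; [exact ab| | |].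
  - apply continuous_beyond_ex_DInt; assumption.
  - apply continuous_beyond_ex_DInt; assumption.
  - intros x Hx. apply RInt_le; [exact cd| | |].
    + apply (continuous_beyond_ex_RInt T); [assumption|lra].
    + apply (continuous_beyond_ex_RInt T); [assumption|lra].
    + intros y Hy. apply H; assumption.
Qed.

Lemma DInt_const k : DInt a b c d (fun _ _ => k) = (b - a) * ((d - c) * k).
Proof.
  unfold DInt. rewrite (RInt_const (V := R_CompleteNormedModule)).
  rewrite (RInt_const (V := R_CompleteNormedModule)). reflexivity.
Qed.

Lemma DInt_ge_0 F :
  continuous_beyond T F ->
  (forall x y, a < x < b -> c < y < d -> 0 <= F x y) ->
  0 <= DInt a b c d F.
Proof.
  intros HF H. replace 0 with (DInt a b c d (fun _ _ => 0)).
  - apply DInt_le; [|exact HF|exact H].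
    intros x y _. apply continuity_2d_pt_const.
  - rewrite DInt_const. ring.
Qed.

End DoubleIntegral.

Lemma RInt_subset f a b a' b' :
  a <= a' -> a' <= b' -> b' <= b ->
  (forall x, a <= x <= b -> continuous f x) ->
  (forall x, a < x < b -> 0 <= f x) ->
  RInt f a' b' <= RInt f a b.
Proof.
  intros H1 H2 H3 Hc Hp.
  assert (Hex : forall u v, a <= u -> u <= v -> v <= b -> ex_RInt f u v).
  { intros u v Hu Huv Hv. apply (ex_RInt_continuous (V := R_CompleteNormedModule)).
    intros z Hz. rewrite Rmin_left, Rmax_right in Hz by exact Huv. apply Hc. lra. }
  rewrite <- (RInt_Chasles f a a' b) by (apply Hex; lra).
  rewrite <- (RInt_Chasles f a' b' b) by (apply Hex; lra).
  assert (0 <= RInt f a a').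
  { apply RInt_ge_0; [lra|apply Hex; lra|]. intros x Hx. apply Hp. lra. }
  assert (0 <= RInt f b' b).
  { apply RInt_ge_0; [lra|apply Hex; lra|]. intros x Hx. apply Hp. lra. }
  change (RInt f a' b' <= RInt f a a' + (RInt f a' b' + RInt f b' b)). lra.
Qed.

Lemma DInt_subset T a b c d a' b' c' d' F :
  T < a -> a <= a' -> a' <= b' -> b' <= b -> c <= c' -> c' <= d' -> d' <= d ->
  continuous_beyond T F ->
  (forall x y, a < x < b -> c < y < d -> 0 <= F x y) ->
  DInt a' b' c' d' F <= DInt a b c d F.
Proof.
  intros Ta H1 H2 H3 H4 H5 H6 HF Hp. unfold DInt.
  apply Rle_trans with (RInt (fun x => RInt (F x) c d) a' b').
  - apply RInt_le; [exact H2| | |].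
    + apply (continuous_beyond_ex_DInt T); auto; lra.
    + apply (continuous_beyond_ex_DInt T); auto; lra.
    + intros x Hx. apply RInt_subset; try assumption.
      * intros y _. apply continuity_2d_pt_snd, HF. lra.
      * intros y Hy. apply Hp; lra.
  - apply RInt_subset; try assumption.
    + intros x Hx. apply (continuous_beyond_RInt T); [lra|exact HF|lra].
    + intros x Hx. apply RInt_ge_0; [lra| |].
      * apply (continuous_beyond_ex_RInt T); [assumption|lra].
      * intros y Hy. apply Hp; lra.
Qed.

Lemma is_derive_zero_const f a b :
  a <= b -> (forall x, a <= x <= b -> is_derive f x 0) -> f b = f a.
Proof.
  intros Hab H.
  destruct (MVT_gen f a b (fun _ => 0)) as [z [_ Hz]].
  - intros x Hx. apply H. rewrite Rmin_left, Rmax_right in Hx by exact Hab. lra.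
  - intros x Hx. rewrite Rmin_left, Rmax_right in Hx by exact Hab.
    apply continuity_pt_filterlim. apply (ex_derive_continuous (V := R_NormedModule)).
    exists 0. apply H. lra.
  - lra.
Qed.

(** Both sides, as functions of the upper abscissa [b], have derivative
    [RInt (F b) c d] and vanish at [b = a]. *)
Lemma DInt_Fubini T a b c d F :
  T < a -> a <= b -> c <= d -> continuous_beyond T F ->
  DInt a b c d F = RInt (fun y => RInt (fun x => F x y) a b) c d.
Proof.
  intros Ta ab cd HF.
  set (E := fun z => RInt (fun x => RInt (F x) c d) a z
                     - RInt (fun y => RInt (fun x => F x y) a z) c d).
  assert (Hin : forall y u, a - (a - T) / 2 <= u ->
     is_derive (fun z => RInt (fun x => F x y) a z) u (F u y)).
  { intros y u Hu.
    apply (is_derive_RInt (V := R_NormedModule) (fun x => F x y) _ a).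
    - apply (filter_imp (fun z => T < z)); [|apply locally_gt; lra].
      intros z Hz. apply (RInt_correct (V := R_CompleteNormedModule)).
      apply (ex_RInt_continuous (V := R_CompleteNormedModule)).
      intros t Ht. apply (continuity_2d_pt_fst F), HF.
      apply Rlt_le_trans with (2 := proj1 Ht). apply Rmin_glb_lt; lra.
    - apply (continuity_2d_pt_fst F), HF. lra. }
  assert (HE : E b = E a).
  { apply is_derive_zero_const; [exact ab|]. intros z Hz.
    replace 0 with (RInt (F z) c d - RInt (F z) c d) by ring.
    apply (is_derive_minus (V := R_NormedModule)).
    - apply (is_derive_RInt (V := R_NormedModule) (fun x => RInt (F x) c d) _ a).
      + apply (filter_imp (fun z => T < z)); [|apply locally_gt; lra].
        intros z' Hz'. apply (RInt_correct (V := R_CompleteNormedModule)).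
        apply (ex_RInt_continuous (V := R_CompleteNormedModule)).
        intros t Ht. apply (continuous_beyond_RInt T); [exact cd|exact HF|].
        apply Rlt_le_trans with (2 := proj1 Ht). apply Rmin_glb_lt; lra.
      + apply (continuous_beyond_RInt T); [exact cd|exact HF|lra].
    - assert (HD : forall u y, a - (a - T) / 2 <= u ->
        Derive (fun z0 => RInt (fun x => F x y) a z0) u = F u y).
      { intros u y Hu. apply is_derive_unique, Hin, Hu. }
      rewrite <- (RInt_ext (fun y => Derive (fun z0 => RInt (fun x => F x y) a z0) z)).
      2:{ intros y _. apply HD. lra. }
      apply (is_derive_RInt_param (fun z0 y => RInt (fun x => F x y) a z0)).
      + apply (filter_imp (fun z => a - (a - T) / 2 < z)); [|apply locally_gt; lra].
        intros u Hu y _. exists (F u y). apply Hin. lra.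
      + intros y _. apply continuity_2d_pt_ext_loc with F; [|apply HF; lra].
        assert (Hp : 0 < (a - T) / 2) by lra.
        exists (mkposreal _ Hp). simpl. intros u v Hu _.
        symmetry. apply HD. apply Rabs_def2 in Hu. lra.
      + apply (filter_imp (fun z => T < z)); [|apply locally_gt; lra].
        intros z' Hz'. apply (ex_RInt_continuous (V := R_CompleteNormedModule)).
        intros y _.
        destruct (Rle_dec a z') as [Haz|Haz].
        * apply (continuous_RInt_param (fun y x => F x y)); [exact Haz| |].
          -- intros x Hx. apply (continuity_2d_pt_swap F), HF. lra.
          -- apply filter_forall. intros t.
             apply (ex_RInt_continuous (V := R_CompleteNormedModule)).
             intros x Hx. rewrite Rmin_left in Hx by exact Haz.
             apply (continuity_2d_pt_fst F), HF. lra.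
        * apply (continuous_ext (fun y => - RInt (fun x => F x y) z' a)).
          { intros y'. symmetry. rewrite <- (opp_RInt_swap (V := R_CompleteNormedModule)). reflexivity.
            apply (ex_RInt_continuous (V := R_CompleteNormedModule)).
             intros x Hx. rewrite Rmin_left in Hx by lra.
             apply (continuity_2d_pt_fst F), HF. lra. }
          apply (continuous_opp (V := R_NormedModule)).
          apply (continuous_RInt_param (fun y x => F x y)); [lra| |].
          -- intros x Hx. apply (continuity_2d_pt_swap F), HF. lra.
          -- apply filter_forall. intros t.
             apply (ex_RInt_continuous (V := R_CompleteNormedModule)).
             intros x Hx. rewrite Rmin_left in Hx by lra.
             apply (continuity_2d_pt_fst F), HF. lra. }
  assert (HEa : E a = 0).
  { unfold E. rewrite (RInt_point (V := R_CompleteNormedModule)).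
    rewrite (RInt_ext _ (fun _ => 0)).
    - rewrite (RInt_const (V := R_CompleteNormedModule)).
      change (0 - (d - c) * 0 = 0). ring.
    - intros y _. apply (RInt_point (V := R_CompleteNormedModule)). }
  unfold DInt. unfold E in HE at 1. lra.
Qed.

(** * Functions of class C^2 on a half-plane *)

(** The derivatives are carried as explicit functions, so that those of sums and
    compositions can be written down. *)
Record C2_beyond (T : R) (V Vx Vxx Vy Vyy : R -> R -> R) : Prop := {
  C2_cont : continuous_beyond T V;
  C2_cont_x : continuous_beyond T Vx;
  C2_cont_xx : continuous_beyond T Vxx;
  C2_cont_y : continuous_beyond T Vy;
  C2_cont_yy : continuous_beyond T Vyy;
  C2_dx : forall x y, T < x -> is_derive (fun t => V t y) x (Vx x y);
  C2_dxx : forall x y, T < x -> is_derive (fun t => Vx t y) x (Vxx x y);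
  C2_dy : forall x y, T < x -> is_derive (fun t => V x t) y (Vy x y);
  C2_dyy : forall x y, T < x -> is_derive (fun t => Vy x t) y (Vyy x y)
}.

Lemma continuous_beyond_mult T F G :
  continuous_beyond T F -> continuous_beyond T G ->
  continuous_beyond T (fun x y => F x y * G x y).
Proof. intros HF HG x y H. apply continuity_2d_pt_mult; auto. Qed.

Lemma continuous_beyond_plus T F G :
  continuous_beyond T F -> continuous_beyond T G ->
  continuous_beyond T (fun x y => F x y + G x y).
Proof. intros HF HG x y H. apply continuity_2d_pt_plus; auto. Qed.

Lemma continuous_beyond_minus T F G :
  continuous_beyond T F -> continuous_beyond T G ->
  continuous_beyond T (fun x y => F x y - G x y).
Proof. intros HF HG x y H. apply continuity_2d_pt_minus; auto. Qed.

Lemma continuous_beyond_opp T F :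
  continuous_beyond T F -> continuous_beyond T (fun x y => - F x y).
Proof. intros HF x y H. apply continuity_2d_pt_opp; auto. Qed.

Lemma continuous_beyond_const T k : continuous_beyond T (fun _ _ => k).
Proof. intros x y _. apply continuity_2d_pt_const. Qed.

Lemma continuous_beyond_comp T (phi : R -> R) F :
  (forall z, continuous phi z) -> continuous_beyond T F ->
  continuous_beyond T (fun x y => phi (F x y)).
Proof.
  intros Hp HF x y H. apply continuity_2d_pt_comp_continuous; auto.
Qed.

Ltac cont_beyond :=
  repeat first
    [ assumption | apply continuous_beyond_const
    | apply continuous_beyond_plus | apply continuous_beyond_minus
    | apply continuous_beyond_mult | apply continuous_beyond_opp ].

(** * Green's identity on rectangles *)

Lemma integration_by_parts_twice (f f' f'' p p' p'' : R -> R) a b :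
  a <= b ->
  (forall x, a <= x <= b -> is_derive f x (f' x)) ->
  (forall x, a <= x <= b -> is_derive f' x (f'' x)) ->
  (forall x, a <= x <= b -> is_derive p x (p' x)) ->
  (forall x, a <= x <= b -> is_derive p' x (p'' x)) ->
  (forall x, a <= x <= b -> continuous f'' x) ->
  (forall x, a <= x <= b -> continuous p'' x) ->
  p a = 0 -> p' a = 0 -> p b = 0 -> p' b = 0 ->
  RInt (fun x => f'' x * p x - f x * p'' x) a b = 0.
Proof.
  intros ab Df Df' Dp Dp' Cf Cp pa pa' pb pb'.
  assert (HC : forall g g' x, is_derive (K := R_AbsRing) (V := R_NormedModule) g x g' -> continuous g x).
  { intros g g' x Hg. apply (ex_derive_continuous (V := R_NormedModule)). exists g'. exact Hg. }
  rewrite (is_RInt_unique (V := R_CompleteNormedModule) _ a b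
    (minus (f' b * p b - f b * p' b) (f' a * p a - f a * p' a))).
  - rewrite pa, pa', pb, pb'. unfold minus, plus, opp. simpl. ring.
  - apply (is_RInt_derive (V := R_CompleteNormedModule) (fun x => f' x * p x - f x * p' x)).
    + intros x Hx. rewrite Rmin_left, Rmax_right in Hx by exact ab.
      replace (f'' x * p x - f x * p'' x)
        with ((f'' x * p x + f' x * p' x) - (f' x * p' x + f x * p'' x)) by ring.
      apply (is_derive_minus (V := R_NormedModule)).
      * apply (is_derive_mult (K := R_AbsRing) f' p); auto. intros; apply Rmult_comm.
      * apply (is_derive_mult (K := R_AbsRing) f p'); auto. intros; apply Rmult_comm.
    + intros x Hx. rewrite Rmin_left, Rmax_right in Hx by exact ab.
      apply (continuous_minus (V := R_NormedModule)).
      * apply (continuous_mult (K := R_AbsRing) f'' p); auto. apply (HC p (p' x)); auto.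
      * apply (continuous_mult (K := R_AbsRing) f p''); auto. apply (HC f (f' x)); auto.
Qed.

Lemma Green_identity T a b c d V Vx Vxx Vy Vyy P Px Pxx Py Pyy :
  T < a -> a <= b -> c <= d ->
  C2_beyond T V Vx Vxx Vy Vyy -> C2_beyond T P Px Pxx Py Pyy ->
  (forall y, c <= y <= d -> P a y = 0 /\ Px a y = 0 /\ P b y = 0 /\ Px b y = 0) ->
  (forall x, a <= x <= b -> P x c = 0 /\ Py x c = 0 /\ P x d = 0 /\ Py x d = 0) ->
  DInt a b c d (fun x y => (Vxx x y + Vyy x y) * P x y)
  = DInt a b c d (fun x y => V x y * (Pxx x y + Pyy x y)).
Proof.
  intros Ta ab cd [V0 V1 V2 V3 V4 V5 V6 V7 V8] [P0 P1 P2 P3 P4 P5 P6 P7 P8] HPx HPy.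
  assert (Ex : DInt a b c d (fun x y => Vxx x y * P x y - V x y * Pxx x y) = 0).
  { rewrite (DInt_Fubini T) by (auto; cont_beyond).
    rewrite (RInt_ext _ (fun _ => 0)).
    - rewrite (RInt_const (V := R_CompleteNormedModule)).
      change ((d - c) * 0 = 0). ring.
    - intros y Hy. rewrite Rmin_left, Rmax_right in Hy by exact cd.
      destruct (HPx y) as (H1 & H2 & H3 & H4); [lra|].
      apply (integration_by_parts_twice (fun x => V x y) (fun x => Vx x y)
        (fun x => Vxx x y) (fun x => P x y) (fun x => Px x y) (fun x => Pxx x y));
        auto; intros x Hx; try (apply V5 || apply V6 || apply P5 || apply P6);
        try (apply continuity_2d_pt_fst; (apply V2 || apply P2)); lra. }
  assert (Ey : DInt a b c d (fun x y => Vyy x y * P x y - V x y * Pyy x y) = 0).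
  { unfold DInt. rewrite (RInt_ext _ (fun _ => 0)).
    - rewrite (RInt_const (V := R_CompleteNormedModule)).
      change ((b - a) * 0 = 0). ring.
    - intros x Hx. rewrite Rmin_left, Rmax_right in Hx by exact ab.
      destruct (HPy x) as (H1 & H2 & H3 & H4); [lra|].
      apply (integration_by_parts_twice (V x) (Vy x) (Vyy x) (P x) (Py x) (Pyy x));
        auto; intros y Hy; try (apply V7 || apply V8 || apply P7 || apply P8);
        try (apply continuity_2d_pt_snd; (apply V4 || apply P4)); lra. }
  assert (E : DInt a b c d (fun x y => (Vxx x y + Vyy x y) * P x y) =
    DInt a b c d (fun x y => V x y * (Pxx x y + Pyy x y)) +
    (DInt a b c d (fun x y => Vxx x y * P x y - V x y * Pxx x y)
     + DInt a b c d (fun x y => Vyy x y * P x y - V x y * Pyy x y))).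
  { rewrite <- !(DInt_plus T) by (auto; cont_beyond).
    unfold DInt. apply RInt_ext. intros x _. apply RInt_ext. intros y _. simpl. ring. }
  rewrite E, Ex, Ey. ring.
Qed.

(** * A smoothed logarithmic test function *)

(** Powers of the positive part are the building blocks of both cut-offs used
    below, as the [n]-th power is of class C^(n-1). *)
Definition ppart (l : R) : R := Rmax l 0.

Lemma ppart_pos l : 0 <= l -> ppart l = l.
Proof. intros H. apply Rmax_left, H. Qed.

Lemma ppart_neg l : l <= 0 -> ppart l = 0.
Proof. intros H. apply Rmax_right, H. Qed.

Lemma ppart_ge_0 l : 0 <= ppart l.
Proof. apply Rmax_r. Qed.

Lemma continuous_ppart l : continuous ppart l.
Proof.
  apply (continuous_ext (fun x => (x + Rabs x) / 2)).
  - intros x. unfold ppart. destruct (Rle_dec 0 x).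
    + rewrite Rabs_pos_eq, Rmax_left by assumption. lra.
    + rewrite Rabs_left, Rmax_right by lra. lra.
  - apply (continuous_scal_l (K := R_AbsRing) (V := R_NormedModule) (fun x => x + Rabs x)).
    apply (continuous_plus (V := R_NormedModule)); [apply continuous_id|apply continuous_Rabs].
Qed.

Lemma is_derive_ppart_pow n l :
  is_derive (fun t => ppart t ^ S (S n)) l (INR (S (S n)) * ppart l ^ S n).
Proof.
  destruct (Rtotal_order l 0) as [H|[H|H]].
  - apply (is_derive_ext_loc (fun _ => 0)).
    + apply (filter_imp (fun t => t < 0)); [|apply open_lt, H].
      intros t Ht. rewrite ppart_neg by lra. simpl. ring.
    + rewrite ppart_neg by lra. simpl pow. rewrite Rmult_0_l, Rmult_0_r.
      apply (is_derive_const (V := R_NormedModule)).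
  - subst l. rewrite ppart_neg by lra.
    replace (INR (S (S n)) * 0 ^ S n) with 0 by (simpl; ring).
    apply is_derive_Reals. intros eps Heps.
    assert (Hd : 0 < Rmin eps 1) by (apply Rmin_pos; lra).
    exists (mkposreal _ Hd). simpl. intros h Hh Hlt.
    rewrite Rplus_0_l, (ppart_neg 0) by lra.
    assert (H1 := Rlt_le_trans _ _ _ Hlt (Rmin_l _ _)).
    assert (H2 := Rlt_le_trans _ _ _ Hlt (Rmin_r _ _)).
    destruct (Rle_dec 0 h) as [H0|H0].
    + rewrite ppart_pos by exact H0. rewrite Rabs_pos_eq in H1, H2 by exact H0.
      replace ((h * (h * h ^ n) - 0 * (0 * 0 ^ n)) / h - 0) with (h * h ^ n) by (field; exact Hh).
      assert (0 <= h ^ n) by (apply pow_le; exact H0).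
      assert (h ^ n <= 1 ^ n) by (apply pow_incr; lra).
      rewrite pow1 in *. rewrite Rabs_pos_eq by nra. nra.
    + rewrite ppart_neg by lra.
      replace ((0 * (0 * 0 ^ n) - 0 * (0 * 0 ^ n)) / h - 0) with 0 by (field; exact Hh).
      rewrite Rabs_R0. exact Heps.
  - apply (is_derive_ext_loc (fun t => t ^ S (S n))).
    + apply (filter_imp (fun t => 0 < t)); [|apply open_gt, H].
      intros t Ht. rewrite ppart_pos by lra. reflexivity.
    + rewrite ppart_pos by lra. auto_derive; [trivial|].
      rewrite S_INR. change (1 * ((INR (S n) + 1) * l ^ S n) = (INR (S n) + 1) * l ^ S n). ring.
Qed.

(** A C^2 substitute for the positive part: the second derivative is the tent on
    [[0, 1]] of height 2, so [ramp] vanishes for [l <= 0] and equals [l - 1/2] for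
    [l >= 1]. *)
Definition ramp (l : R) : R :=
  2 / 3 * (ppart l ^ 3 - 2 * ppart (l - 1 / 2) ^ 3 + ppart (l - 1) ^ 3).
Definition ramp' (l : R) : R :=
  2 * (ppart l ^ 2 - 2 * ppart (l - 1 / 2) ^ 2 + ppart (l - 1) ^ 2).
Definition ramp'' (l : R) : R :=
  4 * (ppart l - 2 * ppart (l - 1 / 2) + ppart (l - 1)).

Lemma is_derive_ppart_pow_shift n k l :
  is_derive (fun t => ppart (t - k) ^ S (S n)) l (INR (S (S n)) * ppart (l - k) ^ S n).
Proof.
  replace (INR (S (S n)) * ppart (l - k) ^ S n)
    with (scal 1 (INR (S (S n)) * ppart (l - k) ^ S n)) by apply Rmult_1_l.
  apply (is_derive_comp (fun t => ppart t ^ S (S n)) (fun t => t - k)).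
  - apply is_derive_ppart_pow.
  - auto_derive; [trivial|ring].
Qed.

Lemma is_derive_ramp l : is_derive ramp l (ramp' l).
Proof.
  unfold ramp'.
  replace (2 * (ppart l ^ 2 - 2 * ppart (l - 1 / 2) ^ 2 + ppart (l - 1) ^ 2))
    with (2 / 3 * (INR 3 * ppart l ^ 2 - 2 * (INR 3 * ppart (l - 1 / 2) ^ 2)
          + INR 3 * ppart (l - 1) ^ 2)) by (simpl INR; field).
  apply (is_derive_scal (fun l => ppart l ^ 3 - 2 * ppart (l - 1 / 2) ^ 3 + ppart (l - 1) ^ 3)).
  apply (is_derive_plus (V := R_NormedModule)).
  - apply (is_derive_minus (V := R_NormedModule)).
    + apply (is_derive_ppart_pow 1).
    + apply (is_derive_scal (fun l => ppart (l - 1 / 2) ^ 3)).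
      apply (is_derive_ppart_pow_shift 1).
  - apply (is_derive_ppart_pow_shift 1).
Qed.

Lemma is_derive_ramp' l : is_derive ramp' l (ramp'' l).
Proof.
  unfold ramp''.
  replace (4 * (ppart l - 2 * ppart (l - 1 / 2) + ppart (l - 1)))
    with (2 * (INR 2 * ppart l ^ 1 - 2 * (INR 2 * ppart (l - 1 / 2) ^ 1)
          + INR 2 * ppart (l - 1) ^ 1)) by (simpl INR; ring).
  apply (is_derive_scal (fun l => ppart l ^ 2 - 2 * ppart (l - 1 / 2) ^ 2 + ppart (l - 1) ^ 2)).
  apply (is_derive_plus (V := R_NormedModule)).
  - apply (is_derive_minus (V := R_NormedModule)).
    + apply (is_derive_ppart_pow 0).
    + apply (is_derive_scal (fun l => ppart (l - 1 / 2) ^ 2)).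
      apply (is_derive_ppart_pow_shift 0).
  - apply (is_derive_ppart_pow_shift 0).
Qed.

Lemma continuous_ramp'' l : continuous ramp'' l.
Proof.
  assert (Hs : forall k, continuous (fun t => ppart (t - k)) l).
  { intros k. apply (continuous_comp (fun t => t - k) ppart).
    - apply (continuous_minus (V := R_NormedModule)); [apply continuous_id|apply continuous_const].
    - apply continuous_ppart. }
  apply (continuous_scal_r (K := R_AbsRing) (V := R_NormedModule) 4
    (fun l => ppart l - 2 * ppart (l - 1 / 2) + ppart (l - 1))).
  apply (continuous_plus (V := R_NormedModule)); [|apply Hs].
  apply (continuous_minus (V := R_NormedModule)); [apply continuous_ppart|].
  apply (continuous_scal_r (K := R_AbsRing) (V := R_NormedModule) 2). apply Hs.
Qed.

Lemma ramp_cases l :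
  (l <= 0 /\ ramp l = 0 /\ ramp' l = 0 /\ ramp'' l = 0) \/
  (0 <= l <= 1 /\ 0 <= ramp l <= l /\ 0 <= ramp' l /\ 0 <= ramp'' l <= 2) \/
  (1 <= l /\ ramp l = l - 1 / 2 /\ ramp' l = 1 /\ ramp'' l = 0).
Proof.
  unfold ramp, ramp', ramp''.
  destruct (Rle_dec l 0); [left|right].
  - rewrite !ppart_neg by lra. lra.
  - destruct (Rle_dec l 1); [left|right].
    + rewrite (ppart_pos l), (ppart_neg (l - 1)) by lra.
      destruct (Rle_dec l (1 / 2)).
      * rewrite (ppart_neg (l - 1 / 2)) by lra. repeat split; try lra; nra.
      * rewrite (ppart_pos (l - 1 / 2)) by lra. repeat split; try lra; nra.
    + rewrite !ppart_pos by lra. repeat split; try lra; field.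
Qed.

Section TestFunction.
Variables x0 y0 rho del : R.
Hypotheses (rho_pos : 0 < rho) (del_pos : 0 < del).

(** With [s] the squared distance to the centre, [logw] is
    [ln ((rho^2 + del^2) / (s + del^2))]: up to a factor and a constant, the
    fundamental solution smoothed at the scale [del]. It is nonpositive outside the
    disc of radius [rho], where [bump] therefore vanishes. *)
Definition sqdist (x y : R) : R := (x - x0) * (x - x0) + (y - y0) * (y - y0).
Definition invq (x y : R) : R := / (sqdist x y + del * del).
Definition logw (x y : R) : R :=
  ln (rho * rho + del * del) - ln (sqdist x y + del * del).

Definition bump (x y : R) := ramp (logw x y).
Definition bump_x (x y : R) := ramp' (logw x y) * - (2 * (x - x0) * invq x y).
Definition bump_y (x y : R) := ramp' (logw x y) * - (2 * (y - y0) * invq x y).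
Definition bump_xx (x y : R) :=
  ramp'' (logw x y) * (4 * ((x - x0) * (x - x0)) * (invq x y * invq x y))
  + ramp' (logw x y) * (4 * ((x - x0) * (x - x0)) * (invq x y * invq x y) - 2 * invq x y).
Definition bump_yy (x y : R) :=
  ramp'' (logw x y) * (4 * ((y - y0) * (y - y0)) * (invq x y * invq x y))
  + ramp' (logw x y) * (4 * ((y - y0) * (y - y0)) * (invq x y * invq x y) - 2 * invq x y).

Lemma sqdist_ge_0 x y : 0 <= sqdist x y.
Proof. unfold sqdist. apply Rplus_le_le_0_compat; apply Rle_0_sqr. Qed.

Lemma sqdist_del_pos x y : 0 < sqdist x y + del * del.
Proof. assert (H := sqdist_ge_0 x y). nra. Qed.

Lemma is_derive_logw_x x y : is_derive (fun t => logw t y) x (- (2 * (x - x0) * invq x y)).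
Proof.
  assert (H := sqdist_del_pos x y). unfold logw, invq, sqdist in *.
  auto_derive; [repeat split; lra|]. field. lra.
Qed.

Lemma is_derive_logw_y x y : is_derive (fun t => logw x t) y (- (2 * (y - y0) * invq x y)).
Proof.
  assert (H := sqdist_del_pos x y). unfold logw, invq, sqdist in *.
  auto_derive; [repeat split; lra|]. field. lra.
Qed.

Lemma bump_C2 T : C2_beyond T bump bump_x bump_xx bump_y bump_yy.
Proof.
  assert (Cx : continuous_beyond T (fun x y => x - x0)).
  { intros x y _. apply continuity_2d_pt_minus; [apply continuity_2d_pt_id1|apply continuity_2d_pt_const]. }
  assert (Cy : continuous_beyond T (fun x y => y - y0)).
  { intros x y _. apply continuity_2d_pt_minus; [apply continuity_2d_pt_id2|apply continuity_2d_pt_const]. }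
  assert (Cs : continuous_beyond T (fun x y => sqdist x y + del * del)).
  { unfold sqdist. cont_beyond. }
  assert (Ci : continuous_beyond T invq).
  { intros x y H. apply continuity_2d_pt_inv; [apply Cs, H|].
    assert (H1 := sqdist_del_pos x y). lra. }
  assert (Cl : continuous_beyond T logw).
  { intros x y H. apply continuity_2d_pt_minus; [apply continuity_2d_pt_const|].
    apply continuity_2d_pt_comp_continuous; [|apply Cs, H].
    apply (ex_derive_continuous (V := R_NormedModule)).
    exists (/ (sqdist x y + del * del)). apply is_derive_ln, sqdist_del_pos. }
  assert (C0 : continuous_beyond T (fun x y => ramp (logw x y))).
  { apply continuous_beyond_comp; [|exact Cl]. intros z.
    apply (ex_derive_continuous (V := R_NormedModule)). exists (ramp' z). apply is_derive_ramp. }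
  assert (C1 : continuous_beyond T (fun x y => ramp' (logw x y))).
  { apply continuous_beyond_comp; [|exact Cl]. intros z.
    apply (ex_derive_continuous (V := R_NormedModule)). exists (ramp'' z). apply is_derive_ramp'. }
  assert (C2 : continuous_beyond T (fun x y => ramp'' (logw x y))).
  { apply continuous_beyond_comp; [|exact Cl]. apply continuous_ramp''. }
  split; unfold bump, bump_x, bump_y, bump_xx, bump_yy; cont_beyond; intros x y _.
  - rewrite Rmult_comm. apply (is_derive_comp ramp (fun t => logw t y)).
    + apply is_derive_ramp.
    + apply is_derive_logw_x.
  - apply is_derive_ext with (fun t => ramp' (logw t y) * - (2 * (t - x0) * invq t y)); [reflexivity|].
    replace (ramp'' (logw x y) * (4 * ((x - x0) * (x - x0)) * (invq x y * invq x y)) +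
     ramp' (logw x y) * (4 * ((x - x0) * (x - x0)) * (invq x y * invq x y) - 2 * invq x y))
    with ((- (2 * (x - x0) * invq x y) * ramp'' (logw x y)) * - (2 * (x - x0) * invq x y) +
     ramp' (logw x y) * (4 * ((x - x0) * (x - x0)) * (invq x y * invq x y) - 2 * invq x y)) by ring.
    apply (is_derive_mult (K := R_AbsRing) (fun t => ramp' (logw t y)) (fun t => - (2 * (t - x0) * invq t y))).
    + apply (is_derive_comp ramp' (fun t => logw t y)); [apply is_derive_ramp'|apply is_derive_logw_x].
    + assert (H := sqdist_del_pos x y). unfold invq, sqdist in *.
      auto_derive; [repeat split; lra|]. field. lra.
    + intros; apply Rmult_comm.
  - rewrite Rmult_comm. apply (is_derive_comp ramp (fun t => logw x t)).
    + apply is_derive_ramp.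
    + apply is_derive_logw_y.
  - replace (ramp'' (logw x y) * (4 * ((y - y0) * (y - y0)) * (invq x y * invq x y)) +
     ramp' (logw x y) * (4 * ((y - y0) * (y - y0)) * (invq x y * invq x y) - 2 * invq x y))
    with ((- (2 * (y - y0) * invq x y) * ramp'' (logw x y)) * - (2 * (y - y0) * invq x y) +
     ramp' (logw x y) * (4 * ((y - y0) * (y - y0)) * (invq x y * invq x y) - 2 * invq x y)) by ring.
    apply (is_derive_mult (K := R_AbsRing) (fun t => ramp' (logw x t)) (fun t => - (2 * (t - y0) * invq x t))).
    + apply (is_derive_comp ramp' (fun t => logw x t)); [apply is_derive_ramp'|apply is_derive_logw_y].
    + assert (H := sqdist_del_pos x y). unfold invq, sqdist in *.
      auto_derive; [repeat split; lra|]. field. lra.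
    + intros; apply Rmult_comm.
Qed.

(** The Laplacian of [logw] is [- 4 del^2 / (s + del^2)^2], an approximate Dirac
    mass of scale [del]; the term with [ramp''] comes from the truncation and lives
    at distance comparable to [rho]. *)
Lemma bump_laplacian x y :
  bump_xx x y + bump_yy x y
  = ramp'' (logw x y) * (4 * sqdist x y * (invq x y * invq x y))
    - ramp' (logw x y) * (4 * (del * del) * (invq x y * invq x y)).
Proof.
  assert (H := sqdist_del_pos x y). unfold bump_xx, bump_yy, invq, sqdist in *.
  field. lra.
Qed.

Lemma logw_le_0 x y : rho * rho <= sqdist x y -> logw x y <= 0.
Proof.
  intros H. unfold logw.
  assert (ln (rho * rho + del * del) <= ln (sqdist x y + del * del)); [|lra].
  apply ln_le; nra.
Qed.

Lemma bump_outside x y :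
  rho * rho <= sqdist x y -> bump x y = 0 /\ bump_x x y = 0 /\ bump_y x y = 0.
Proof.
  intros H. apply logw_le_0 in H. unfold bump, bump_x, bump_y.
  destruct (ramp_cases (logw x y)) as [(_ & -> & -> & _)|[(H1 & H2 & H3 & H4)|(H1 & _)]].
  - repeat split; ring.
  - unfold ramp, ramp' in *. rewrite !ppart_neg by lra. repeat split; ring.
  - lra.
Qed.

Lemma bump_ge_0 x y : 0 <= bump x y.
Proof.
  unfold bump.
  destruct (ramp_cases (logw x y)) as [(_ & -> & _)|[(H1 & H2 & _)|(H1 & -> & _)]]; lra.
Qed.

Lemma bump_le z x y : 0 <= z -> logw x y <= z -> bump x y <= z.
Proof.
  unfold bump. intros Hz Hl.
  destruct (ramp_cases (logw x y)) as [(_ & -> & _)|[(H1 & H2 & _)|(H1 & -> & _)]]; lra.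
Qed.

(** Where [ramp''] does not vanish, [logw <= 1], that is
    [s + del^2 >= (rho^2 + del^2) / e], and [e <= 3]. *)
Lemma bump_transition_bound x y :
  ramp'' (logw x y) * (4 * sqdist x y * (invq x y * invq x y)) <= 24 / (rho * rho).
Proof.
  assert (Hr : 0 < rho * rho) by nra.
  assert (Hd : 0 < del * del) by nra.
  assert (H0 : 0 <= 24 / (rho * rho)) by (apply Rlt_le, Rdiv_lt_0_compat; lra).
  assert (Hs := sqdist_ge_0 x y). assert (Hq := sqdist_del_pos x y).
  assert (Hi : 0 < invq x y) by (apply Rinv_0_lt_compat, Hq).
  assert (Hsi : sqdist x y * invq x y <= 1).
  { unfold invq. apply Rle_trans with ((sqdist x y + del * del) * / (sqdist x y + del * del)).
    - apply Rmult_le_compat_r; [apply Rlt_le, Hi|lra].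
    - rewrite Rinv_r by lra. lra. }
  assert (Hsi0 : 0 <= sqdist x y * invq x y) by (apply Rmult_le_pos; lra).
  destruct (ramp_cases (logw x y)) as [(_ & _ & _ & ->)|[(H1 & _ & _ & H4)|(_ & _ & _ & ->)]].
  - lra.
  - assert (Hb : (rho * rho + del * del) / 3 <= sqdist x y + del * del).
    { assert (E : ln (rho * rho + del * del) <= 1 + ln (sqdist x y + del * del))
        by (unfold logw in H1; lra).
      apply Rnot_lt_le.
      intros Hlt.
      assert (ln (3 * (sqdist x y + del * del)) < ln (rho * rho + del * del)).
      { apply ln_increasing; lra. }
      rewrite ln_mult in H by lra.
      assert (1 <= ln 3).
      { rewrite <- (ln_exp 1). apply ln_le; [apply exp_pos|apply exp_le_3]. }
      lra. }
    assert (Hi2 : invq x y <= 3 / (rho * rho)).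
    { unfold invq. replace (3 / (rho * rho)) with (/ (rho * rho / 3)) by (field; lra).
      apply Rinv_le_contravar; lra. }
    replace (24 / (rho * rho)) with (2 * (4 * (3 / (rho * rho)))) by (field; lra).
    assert (sqdist x y * (invq x y * invq x y) <= 3 / (rho * rho)) by nra.
    assert (0 <= sqdist x y * (invq x y * invq x y)) by nra.
    rewrite (Rmult_assoc 4). nra.
  - lra.
Qed.

(** On the square of half-side [del] one has [s + del^2 <= 3 del^2]; the condition
    [del <= rho / 3] makes [logw >= 1] there, so that [ramp'] equals 1. *)
Lemma bump_core_bound x y :
  del <= rho / 3 -> Rabs (x - x0) <= del -> Rabs (y - y0) <= del ->
  4 / (9 * (del * del)) <= ramp' (logw x y) * (4 * (del * del) * (invq x y * invq x y)).
Proof.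
  intros Hdr Hx Hy. apply Rabs_le_between in Hx. apply Rabs_le_between in Hy.
  assert (Hd : 0 < del * del) by nra.
  assert (Hs := sqdist_ge_0 x y). assert (Hq := sqdist_del_pos x y).
  assert (Hs2 : sqdist x y + del * del <= 3 * (del * del)) by (unfold sqdist; nra).
  assert (HL : 1 <= logw x y).
  { unfold logw.
    assert (ln (exp 1 * (sqdist x y + del * del)) <= ln (rho * rho + del * del)).
    { assert (He := exp_le_3). assert (Hep := exp_pos 1).
      apply ln_le; [nra|]. nra. }
    rewrite ln_mult, ln_exp in H by (try apply exp_pos; lra). lra. }
  replace (ramp' (logw x y)) with 1.
  2:{ destruct (ramp_cases (logw x y)) as [(H & _)|[(H & _ & _ & _)|(_ & _ & -> & _)]]; try lra.
      replace (logw x y) with 1 by lra. unfold ramp'. rewrite !ppart_pos by lra. field. }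
  assert (Hi : / (3 * (del * del)) <= invq x y) by (apply Rinv_le_contravar; lra).
  assert (Hi0 : 0 < / (3 * (del * del))) by (apply Rinv_0_lt_compat; lra).
  replace (4 / (9 * (del * del)))
    with (1 * (4 * (del * del) * (/ (3 * (del * del)) * / (3 * (del * del))))) by (field; lra).
  rewrite !Rmult_1_l. apply Rmult_le_compat_l; [lra|]. nra.
Qed.

End TestFunction.

(** * From averages to values *)

Definition square_int (x0 y0 r : R) (F : R -> R -> R) : R :=
  DInt (x0 - r) (x0 + r) (y0 - r) (y0 + r) F.

Section LocalEstimates.
Variables (T : R) (V Vx Vxx Vy Vyy : R -> R -> R).
Hypothesis HV : C2_beyond T V Vx Vxx Vy Vyy.
Variables x0 y0 rho : R.
Hypotheses (rho_pos : 0 < rho) (Hbox : T < x0 - rho).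
Hypothesis V_ge_0 : forall x y,
  x0 - rho <= x <= x0 + rho -> y0 - rho <= y <= y0 + rho -> 0 <= V x y.

Let h x y := - (Vxx x y + Vyy x y).

Lemma continuous_beyond_source : continuous_beyond T h.
Proof. unfold h. destruct HV. cont_beyond. Qed.

(** Green's identity against [bump], with the core of the approximate Dirac mass
    bounded below and the truncation term bounded above. *)
Lemma small_square_average_le del :
  0 < del <= rho / 3 ->
  4 / (9 * (del * del)) * square_int x0 y0 del V
  <= 24 / (rho * rho) * square_int x0 y0 rho V
     + square_int x0 y0 rho (fun x y => h x y * bump x0 y0 rho del x y).
Proof.
  intros Hdel. unfold square_int.
  assert (Hd : 0 < del * del) by nra.
  assert (HP := bump_C2 x0 y0 rho del (proj1 Hdel) T).
  set (P := bump x0 y0 rho del) in *.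
  set (LP := fun x y => bump_xx x0 y0 rho del x y + bump_yy x0 y0 rho del x y).
  set (k := fun x y => 24 / (rho * rho) + - LP x y).
  assert (Hc := C2_cont _ _ _ _ _ _ HV). assert (Hh := continuous_beyond_source).
  assert (CP : continuous_beyond T P) by apply HP.
  assert (CL : continuous_beyond T LP) by (destruct HP; unfold LP; cont_beyond).
  assert (Ck : continuous_beyond T k) by (unfold k; cont_beyond).
  (* the constant makes up for the truncation term, so that k is nonnegative *)
  assert (Hk : forall x y, k x y >= ramp' (logw x0 y0 rho del x y) *
     (4 * (del * del) * (invq x0 y0 del x y * invq x0 y0 del x y))).
  { intros x y. unfold k, LP. rewrite bump_laplacian by lra.
    assert (H := bump_transition_bound x0 y0 rho del rho_pos (proj1 Hdel) x y). lra. }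
  assert (Hk0 : forall x y, 0 <= k x y).
  { intros x y. apply Rle_trans with (2 := Rge_le _ _ (Hk x y)).
    apply Rmult_le_pos.
    - destruct (ramp_cases (logw x0 y0 rho del x y)) as [H|[H|H]]; lra.
    - apply Rmult_le_pos; [lra|apply Rle_0_sqr]. }
  apply Rle_trans with (DInt (x0 - rho) (x0 + rho) (y0 - rho) (y0 + rho) (fun x y => V x y * k x y)).
  - rewrite <- (DInt_scal T) by (auto; lra).
    apply Rle_trans with (DInt (x0 - del) (x0 + del) (y0 - del) (y0 + del) (fun x y => V x y * k x y)).
    + apply (DInt_le T); try lra; cont_beyond.
      intros x y Hx Hy. rewrite Rmult_comm. apply Rmult_le_compat_l; [apply V_ge_0; lra|].
      apply Rle_trans with (2 := Rge_le _ _ (Hk x y)).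
      apply bump_core_bound; try lra; apply Rabs_le_between; lra.
    + apply (DInt_subset T); try lra; cont_beyond.
      intros x y Hx Hy. apply Rmult_le_pos; [apply V_ge_0; lra|apply Hk0].
  - assert (G : DInt (x0 - rho) (x0 + rho) (y0 - rho) (y0 + rho) (fun x y => (Vxx x y + Vyy x y) * P x y)
       = DInt (x0 - rho) (x0 + rho) (y0 - rho) (y0 + rho) (fun x y => V x y * LP x y)).
    { assert (Hs : forall x y, (x = x0 - rho \/ x = x0 + rho \/ y = y0 - rho \/ y = y0 + rho) ->
         rho * rho <= sqdist x0 y0 x y).
      { intros x y H. unfold sqdist.
        assert (H1 := Rle_0_sqr (x - x0)). assert (H2 := Rle_0_sqr (y - y0)). unfold Rsqr in *.
        destruct H as [H|[H|[H|H]]]; subst; nra. }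
      apply (Green_identity T _ _ _ _ V Vx Vxx Vy Vyy P (bump_x x0 y0 rho del) _ (bump_y x0 y0 rho del)); auto; try lra.
      - intros y Hy.
        destruct (bump_outside x0 y0 rho del (proj1 Hdel) (x0 - rho) y) as (? & ? & ?); [apply Hs; tauto|].
        destruct (bump_outside x0 y0 rho del (proj1 Hdel) (x0 + rho) y) as (? & ? & ?); [apply Hs; tauto|].
        auto.
      - intros x Hx.
        destruct (bump_outside x0 y0 rho del (proj1 Hdel) x (y0 - rho)) as (? & ? & ?); [apply Hs; tauto|].
        destruct (bump_outside x0 y0 rho del (proj1 Hdel) x (y0 + rho)) as (? & ? & ?); [apply Hs; tauto|].
        auto. }
    right.
    transitivity (24 / (rho * rho) * DInt (x0 - rho) (x0 + rho) (y0 - rho) (y0 + rho) V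
       + -1 * DInt (x0 - rho) (x0 + rho) (y0 - rho) (y0 + rho) (fun x y => V x y * LP x y)).
    + rewrite <- !(DInt_scal T) by (try lra; cont_beyond).
      rewrite <- (DInt_plus T) by (try lra; cont_beyond).
      unfold DInt, k. apply RInt_ext. intros x _. apply RInt_ext. intros y _. simpl. ring.
    + f_equal. rewrite <- G.
      rewrite <- (DInt_scal T); try lra.
      2:{ destruct HV. cont_beyond. }
      unfold DInt, h. apply RInt_ext. intros x _. apply RInt_ext. intros y _. simpl. ring.
Qed.

(** The test function is at most its value at the centre, which is logarithmic in
    [del]: this is where a small mass of the source tames the concentration of [V]. *)
Lemma small_square_average_le_mass del :
  0 < del <= rho / 3 ->
  (forall x y, x0 - rho <= x <= x0 + rho -> y0 - rho <= y <= y0 + rho -> 0 <= h x y) ->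
  4 / (9 * (del * del)) * square_int x0 y0 del V
  <= 24 / (rho * rho) * square_int x0 y0 rho V
     + (ln (rho * rho + del * del) - ln (del * del)) * square_int x0 y0 rho h.
Proof.
  intros Hdel Hh.
  apply Rle_trans with (1 := small_square_average_le del Hdel).
  apply Rplus_le_compat_l. unfold square_int.
  assert (HP := bump_C2 x0 y0 rho del (proj1 Hdel) T).
  assert (Hch := continuous_beyond_source).
  assert (CP : continuous_beyond T (bump x0 y0 rho del)) by apply HP.
  assert (Hd : 0 < del * del) by nra.
  rewrite <- (DInt_scal T) by (auto; lra).
  apply (DInt_le T); try lra; cont_beyond.
  intros x y Hx Hy. rewrite Rmult_comm. apply Rmult_le_compat_r; [apply Hh; lra|].
  apply bump_le.
  - assert (ln (del * del) <= ln (rho * rho + del * del)); [|lra]. apply ln_le; nra.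
  - unfold logw. assert (ln (del * del) <= ln (sqdist x0 y0 x y + del * del)); [|lra].
    apply ln_le; [lra|]. assert (H := sqdist_ge_0 x0 y0 x y). lra.
Qed.

(** An explicit primitive exists; the point is that the bound does not depend on
    [del]. *)
Lemma log_kernel_integral del :
  0 < del <= rho ->
  RInt (fun x => ln (2 * (rho * rho)) - ln ((x - x0) * (x - x0) + del * del)) (x0 - rho) (x0 + rho)
  <= 6 * rho.
Proof.
  intros Hdel.
  set (G := fun x => (x - x0) * ln (2 * (rho * rho)) - ((x - x0) * ln ((x - x0) * (x - x0) + del * del)
     - 2 * (x - x0) + 2 * del * atan ((x - x0) / del))).
  assert (Hp : forall x, 0 < (x - x0) * (x - x0) + del * del).
  { intros x. assert (H := Rle_0_sqr (x - x0)). unfold Rsqr in H. nra. }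
  rewrite (is_RInt_unique (V := R_CompleteNormedModule) _ _ _ (minus (G (x0 + rho)) (G (x0 - rho)))).
  - unfold minus, plus, opp, G. simpl.
    replace (x0 + rho - x0) with rho by ring. replace (x0 - rho - x0) with (- rho) by ring.
    replace (- rho * - rho) with (rho * rho) by ring.
    replace (- rho / del) with (- (rho / del)) by (field; lra).
    rewrite atan_opp, ln_mult by nra.
    assert (ln (rho * rho) <= ln (rho * rho + del * del)) by (apply ln_le; nra).
    assert (0 < atan (rho / del)).
    { rewrite <- atan_0. apply atan_increasing. apply Rdiv_lt_0_compat; lra. }
    assert (ln 2 <= 1) by (assert (H9 := ln_lt_2); rewrite <- (ln_exp 1); apply ln_le;
       [lra|]; assert (H8 := exp_ineq1_le 1); lra).
    nra.
  - apply (is_RInt_derive (V := R_CompleteNormedModule) G).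
    + intros x _. unfold G. specialize (Hp x). auto_derive.
      * repeat split; lra.
      * change (x + - x0) with (x - x0).
        generalize (ln ((x - x0) * (x - x0) + del * del)). intros L.
        field. split; [nra|lra].
    + intros x _. apply (continuous_minus (V := R_NormedModule)); [apply continuous_const|].
      specialize (Hp x). apply (ex_derive_continuous (V := R_NormedModule)).
      auto_derive. repeat split; lra.
Qed.

(** By continuity, for [del] small the average over the small square is at least
    half the value at the centre, while the test function has an integral bounded
    independently of [del], being dominated by a logarithm of [x] alone. *)
Lemma center_value_le_square_average A :
  (forall x y, x0 - rho <= x <= x0 + rho -> y0 - rho <= y <= y0 + rho -> 0 <= h x y <= A) ->
  8 / 9 * V x0 y0 <= 24 / (rho * rho) * square_int x0 y0 rho V + 12 * A * (rho * rho).
Proof.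
  intros Hh.
  assert (HA : 0 <= A) by (destruct (Hh x0 y0); lra).
  assert (Hc := C2_cont _ _ _ _ _ _ HV).
  assert (Hr : 0 < rho * rho) by nra.
  destruct (Req_dec (V x0 y0) 0) as [HV0|HV0].
  { rewrite HV0.
    assert (0 <= square_int x0 y0 rho V).
    { apply (DInt_ge_0 T); try lra; auto. intros x y Hx Hy. apply V_ge_0; lra. }
    assert (0 < 24 / (rho * rho)) by (apply Rdiv_lt_0_compat; lra). nra. }
  assert (HVp : 0 < V x0 y0) by (destruct (V_ge_0 x0 y0); lra).
  assert (HV2 : 0 < V x0 y0 / 2) by lra.
  destruct (Hc x0 y0 ltac:(lra) (mkposreal _ HV2)) as [d0 Hd0]. simpl in Hd0.
  set (del := Rmin (d0 / 2) (rho / 3)).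
  assert (Hdel : 0 < del <= rho / 3).
  { split; [|apply Rmin_r]. apply Rmin_pos; [|lra]. assert (0 < d0) by apply cond_pos. lra. }
  assert (Hdel2 : del < d0).
  { apply Rle_lt_trans with (d0 / 2); [apply Rmin_l|]. assert (0 < d0) by apply cond_pos. lra. }
  assert (Hd : 0 < del * del) by nra.
  assert (Hlow : 8 / 9 * V x0 y0 <= 4 / (9 * (del * del)) * square_int x0 y0 del V).
  { replace (8 / 9 * V x0 y0) with
      (4 / (9 * (del * del)) * ((x0 + del - (x0 - del)) * ((y0 + del - (y0 - del)) * (V x0 y0 / 2))))
      by (field; lra).
    apply Rmult_le_compat_l; [apply Rlt_le, Rdiv_lt_0_compat; lra|].
    rewrite <- DInt_const. apply (DInt_le T); try lra; cont_beyond.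
    intros x y Hx Hy.
    assert (H := Hd0 x y ltac:(apply Rabs_def1; lra) ltac:(apply Rabs_def1; lra)).
    apply Rabs_def2 in H. lra. }
  apply Rle_trans with (1 := Hlow).
  apply Rle_trans with (1 := small_square_average_le del Hdel).
  apply Rplus_le_compat_l.
  set (g := fun x (_ : R) => ln (2 * (rho * rho)) - ln ((x - x0) * (x - x0) + del * del)).
  assert (Hp : forall x, 0 < (x - x0) * (x - x0) + del * del).
  { intros x. assert (H := Rle_0_sqr (x - x0)). unfold Rsqr in H. nra. }
  assert (Cg : continuous_beyond T g).
  { apply continuous_beyond_minus; [apply continuous_beyond_const|].
    intros x y _. apply continuity_2d_pt_comp_continuous.
    - apply (ex_derive_continuous (V := R_NormedModule)). eexists.
      apply is_derive_ln, Hp.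
    - apply continuity_2d_pt_plus; [|apply continuity_2d_pt_const].
      apply continuity_2d_pt_mult; (apply continuity_2d_pt_minus; [apply continuity_2d_pt_id1|apply continuity_2d_pt_const]). }
  apply Rle_trans with (A * square_int x0 y0 rho g).
  - unfold square_int. rewrite <- (DInt_scal T) by (auto; lra).
    assert (HP := bump_C2 x0 y0 rho del (proj1 Hdel) T).
    assert (CP : continuous_beyond T (bump x0 y0 rho del)) by apply HP.
    assert (Hch := continuous_beyond_source).
    apply (DInt_le T); try lra; cont_beyond.
    intros x y Hx Hy.
    apply Rmult_le_compat; [apply Hh; lra|apply bump_ge_0|apply Hh; lra|].
    apply bump_le; unfold g.
    + assert (ln ((x - x0) * (x - x0) + del * del) <= ln (2 * (rho * rho))); [|lra].
      apply ln_le; [apply Hp|nra].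
    + unfold logw.
      assert (ln (rho * rho + del * del) <= ln (2 * (rho * rho))) by (apply ln_le; nra).
      assert (ln ((x - x0) * (x - x0) + del * del) <= ln (sqdist x0 y0 x y + del * del)); [|lra].
      apply ln_le; [apply Hp|]. unfold sqdist.
      assert (H1 := Rle_0_sqr (y - y0)). unfold Rsqr in H1. lra.
  - replace (12 * A * (rho * rho)) with (A * (2 * rho * (6 * rho))) by ring.
    apply Rmult_le_compat_l; [exact HA|].
    apply Rle_trans with (2 * rho * RInt (fun x => g x 0) (x0 - rho) (x0 + rho)).
    + right. unfold square_int, DInt.
      change (2 * rho * RInt (fun x => g x 0) (x0 - rho) (x0 + rho))
        with (scal (2 * rho) (RInt (fun x => g x 0) (x0 - rho) (x0 + rho))).
      rewrite <- (RInt_scal (V := R_CompleteNormedModule)).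
      * apply RInt_ext. intros x _. unfold g.
        rewrite (RInt_const (V := R_CompleteNormedModule)).
        f_equal. ring.
      * apply (ex_RInt_continuous (V := R_CompleteNormedModule)). intros x Hx.
        rewrite Rmin_left in Hx by lra.
        apply (continuity_2d_pt_fst g), Cg. lra.
    + apply Rmult_le_compat_l; [lra|]. apply log_kernel_integral. lra.
Qed.

End LocalEstimates.

(** * Circle averages of superharmonic functions *)

(** Three periods are integrated, so that the angles within distance 2 of the
    fundamental domain [[- PI, PI]] lie in the domain of integration. *)
Definition circ (F : R -> R -> R) (x : R) : R := RInt (F x) (- (3 * PI)) (3 * PI).

Lemma circ_bounds : - (3 * PI) <= 3 * PI.
Proof. assert (H := PI_RGT_0). lra. Qed.

Lemma is_derive_circ T F F' x :
  continuous_beyond T F -> continuous_beyond T F' ->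
  (forall u y, T < u -> is_derive (fun t => F t y) u (F' u y)) ->
  T < x -> is_derive (circ F) x (circ F' x).
Proof.
  intros HF HF' HD Hx. unfold circ.
  assert (E : forall u y, T < u -> Derive (fun t => F t y) u = F' u y).
  { intros u y Hu. apply is_derive_unique, HD, Hu. }
  rewrite <- (RInt_ext (fun y => Derive (fun t => F t y) x)) by (intros y _; apply E, Hx).
  apply (is_derive_RInt_param F).
  - apply (filter_imp (fun t => T < t)); [|apply locally_gt, Hx].
    intros u Hu y _. eexists. apply HD, Hu.
  - intros y _. apply continuity_2d_pt_ext_loc with F'; [|apply HF', Hx].
    assert (Hp : 0 < x - T) by lra.
    exists (mkposreal _ Hp). simpl. intros u v Hu _.
    symmetry. apply E. apply Rabs_def2 in Hu. lra.
  - apply (filter_imp (fun t => T < t)); [|apply locally_gt, Hx].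
    intros u Hu. apply (continuous_beyond_ex_RInt T); assumption.
Qed.

Lemma MVT_beyond T F F' a b :
  T < a -> a <= b -> (forall x, T < x -> is_derive F x (F' x)) ->
  exists z, a <= z <= b /\ F b - F a = F' z * (b - a).
Proof.
  intros Ta ab HD.
  destruct (MVT_gen F a b F') as [z Hz].
  - intros x Hx. apply HD. rewrite Rmin_left in Hx by exact ab. lra.
  - intros x Hx. rewrite Rmin_left in Hx by exact ab.
    apply continuity_pt_filterlim. apply (ex_derive_continuous (V := R_NormedModule)).
    exists (F' x). apply HD. lra.
  - rewrite Rmin_left, Rmax_right in Hz by exact ab. exists z. exact Hz.
Qed.

Section CircleAverages.
Variables (T : R) (V Vx Vxx Vy Vyy : R -> R -> R).
Hypothesis HV : C2_beyond T V Vx Vxx Vy Vyy.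
Hypothesis V_periodic : forall x y, T < x -> V x (y + 2 * PI) = V x y.

Let h x y := - (Vxx x y + Vyy x y).

Lemma Vy_periodic x y : T < x -> Vy x (y + 2 * PI) = Vy x y.
Proof.
  intros Hx.
  assert (D : is_derive (fun t => V x (t + 2 * PI)) y (Vy x (y + 2 * PI))).
  { replace (Vy x (y + 2 * PI)) with (scal 1 (Vy x (y + 2 * PI))) by apply Rmult_1_l.
    apply (is_derive_comp (V x) (fun t => t + 2 * PI)).
    - apply (C2_dy _ _ _ _ _ _ HV), Hx.
    - auto_derive; [trivial|ring]. }
  rewrite <- (is_derive_unique _ _ _ D).
  rewrite <- (is_derive_unique _ _ _ (C2_dy _ _ _ _ _ _ HV x y Hx)).
  apply Derive_ext. intros t. apply V_periodic, Hx.
Qed.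

(** By periodicity the second derivative in the angle integrates to zero. *)
Lemma circ_source x : T < x -> circ Vxx x = - circ h x.
Proof.
  intros Hx. destruct HV as [V0 V1 V2 V3 V4 V5 V6 V7 V8].
  assert (E0 : circ Vyy x = 0).
  { unfold circ.
    rewrite (is_RInt_unique (V := R_CompleteNormedModule) (Vyy x) _ _
      (minus (Vy x (3 * PI)) (Vy x (- (3 * PI))))).
    - replace (3 * PI) with (- (3 * PI) + 2 * PI + 2 * PI + 2 * PI) at 1 by ring.
      rewrite !Vy_periodic by exact Hx. apply Rminus_diag_eq. reflexivity.
    - apply (is_RInt_derive (V := R_CompleteNormedModule) (Vy x)).
      + intros y _. apply V8, Hx.
      + intros y _. apply continuity_2d_pt_snd, V4, Hx. }
  assert (E : circ Vxx x = opp (circ h x) - circ Vyy x).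
  { unfold circ.
    rewrite <- (RInt_opp (V := R_CompleteNormedModule)).
    2:{ apply (continuous_beyond_ex_RInt T); [unfold h; cont_beyond|exact Hx]. }
    change (RInt (Vxx x) (- (3 * PI)) (3 * PI) =
      minus (RInt (fun y => opp (h x y)) (- (3 * PI)) (3 * PI)) (RInt (Vyy x) (- (3 * PI)) (3 * PI))).
    rewrite <- (RInt_minus (V := R_CompleteNormedModule)).
    - apply RInt_ext. intros y _. unfold h, minus, plus, opp. simpl. ring.
    - apply (ex_RInt_opp (V := R_NormedModule)).
      apply (continuous_beyond_ex_RInt T); [unfold h; cont_beyond|exact Hx].
    - apply (continuous_beyond_ex_RInt T); [cont_beyond|exact Hx]. }
  rewrite E, E0. change (opp (circ h x)) with (- circ h x). ring.
Qed.

Lemma DInt_source a b :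
  T < a -> a <= b -> DInt a b (- (3 * PI)) (3 * PI) h = circ Vx a - circ Vx b.
Proof.
  intros Ta ab. destruct HV as [V0 V1 V2 V3 V4 V5 V6 V7 V8].
  unfold DInt.
  rewrite (RInt_ext (fun x => RInt (h x) (- (3 * PI)) (3 * PI)) (fun x => opp (circ Vxx x))).
  2:{ intros x Hx. rewrite Rmin_left in Hx by exact ab.
      rewrite circ_source by lra. change (circ h x = - - circ h x). ring. }
  rewrite (is_RInt_unique (V := R_CompleteNormedModule) _ _ _ (opp (minus (circ Vx b) (circ Vx a)))).
  - unfold opp, minus, plus. simpl. unfold opp. simpl. ring.
  - apply (is_RInt_opp (V := R_NormedModule)).
    apply (is_RInt_derive (V := R_CompleteNormedModule) (circ Vx) (circ Vxx)).
    + intros x Hx. rewrite Rmin_left in Hx by exact ab.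
      apply (is_derive_circ T); auto. lra.
    + intros x Hx. rewrite Rmin_left in Hx by exact ab.
      apply (continuous_beyond_RInt T); [apply circ_bounds|auto|lra].
Qed.

Hypothesis V_ge_0 : forall x y, T < x -> 0 <= V x y.
Hypothesis h_ge_0 : forall x y, T < x -> 0 <= h x y.

Lemma circ_slope_decreasing a b : T < a -> a <= b -> circ Vx b <= circ Vx a.
Proof.
  intros Ta ab.
  assert (0 <= DInt a b (- (3 * PI)) (3 * PI) h).
  { destruct HV. apply (DInt_ge_0 T); auto; try apply circ_bounds; unfold h; cont_beyond.
    intros x y Hx _. apply h_ge_0. lra. }
  rewrite DInt_source in H by assumption. lra.
Qed.

Lemma circ_ge_0 x : T < x -> 0 <= circ V x.
Proof.
  intros Hx. apply RInt_ge_0; [apply circ_bounds| |].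
  - apply (continuous_beyond_ex_RInt T); [apply HV|exact Hx].
  - intros y _. apply V_ge_0, Hx.
Qed.

Lemma circ_linear_growth a b :
  T < a -> a <= b -> circ V b <= circ V a + circ Vx a * (b - a).
Proof.
  intros Ta ab. destruct HV as [V0 V1 V2 V3 V4 V5 V6 V7 V8].
  destruct (MVT_beyond T (circ V) (circ Vx) a b Ta ab) as [z [Hz E]].
  { intros x Hx. apply (is_derive_circ T); auto. }
  assert (circ Vx z <= circ Vx a) by (apply circ_slope_decreasing; lra). nra.
Qed.

(** A negative slope somewhere would persist and drive the average below zero. *)
Lemma circ_slope_ge_0 a : T < a -> 0 <= circ Vx a.
Proof.
  intros Ta. apply Rnot_lt_le. intros Hneg.
  set (b := a + (circ V a + 1) / - circ Vx a).
  assert (H0 := circ_ge_0 a Ta).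
  assert (Hd : 0 < (circ V a + 1) / - circ Vx a) by (apply Rdiv_lt_0_compat; lra).
  assert (H1 := circ_linear_growth a b Ta ltac:(unfold b; lra)).
  assert (H2 := circ_ge_0 b ltac:(unfold b; lra)).
  assert (E : circ Vx a * (b - a) = - (circ V a + 1)) by (unfold b; field; lra).
  lra.
Qed.

Lemma circ_increasing a b : T < a -> a <= b -> circ V a <= circ V b.
Proof.
  intros Ta ab. destruct HV as [V0 V1 V2 V3 V4 V5 V6 V7 V8].
  destruct (MVT_beyond T (circ V) (circ Vx) a b Ta ab) as [z [Hz E]].
  { intros x Hx. apply (is_derive_circ T); auto. }
  assert (0 <= circ Vx z) by (apply circ_slope_ge_0; lra). nra.
Qed.

(** The mass of a slab is a drop of the slope, which is monotone and bounded
    below, hence convergent. *)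
Lemma source_mass_vanishes eps :
  0 < eps -> exists T', T < T' /\
    forall a b, T' <= a -> a <= b -> DInt a b (- (3 * PI)) (3 * PI) h <= eps.
Proof.
  intros He.
  destruct (completeness (fun r => exists x, T < x /\ r = - circ Vx x)) as [m [Hub Hlub]].
  - exists 0. intros r [x [Hx ->]]. assert (H := circ_slope_ge_0 x Hx). lra.
  - exists (- circ Vx (T + 1)), (T + 1). split; [lra|reflexivity].
  - assert (Hex : exists x, T < x /\ m - eps < - circ Vx x).
    { apply NNPP. intros Hn. assert (m <= m - eps); [|lra].
      apply Hlub. intros r [x [Hx ->]]. apply Rnot_lt_le. intros Hl.
      apply Hn. exists x. auto. }
    destruct Hex as [T' [HT' Hm]]. exists T'. split; [exact HT'|].
    intros a b Ha Hb. rewrite DInt_source by lra.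
    assert (circ Vx a <= circ Vx T') by (apply circ_slope_decreasing; lra).
    assert (- circ Vx b <= m) by (apply Hub; exists b; split; [lra|reflexivity]).
    lra.
Qed.

End CircleAverages.

(** * Lower bound for positive superharmonic functions *)

Lemma RInt_pos_of_pos_at f a b z :
  a < z < b -> (forall x, a <= x <= b -> continuous f x) ->
  (forall x, a < x < b -> 0 <= f x) -> 0 < f z -> 0 < RInt f a b.
Proof.
  intros Hz Hc Hp Hfz.
  assert (Hl : locally z (fun x => 0 < f x)).
  { apply (Hc z ltac:(lra)). apply open_gt, Hfz. }
  destruct Hl as [e He].
  set (r := Rmin e (Rmin (z - a) (b - z)) / 2).
  assert (He0 := cond_pos e).
  assert (Hm : 0 < Rmin e (Rmin (z - a) (b - z))) by (repeat apply Rmin_pos; lra).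
  assert (Hr : 0 < r /\ r < e /\ r < z - a /\ r < b - z).
  { assert (H1 := Rmin_l e (Rmin (z - a) (b - z))).
    assert (H2 := Rmin_r e (Rmin (z - a) (b - z))).
    assert (H3 := Rmin_l (z - a) (b - z)). assert (H4 := Rmin_r (z - a) (b - z)).
    unfold r. lra. }
  apply Rlt_le_trans with (RInt f (z - r) (z + r)).
  - apply RInt_gt_0; [lra| |].
    + intros x Hx. apply He. apply Rabs_def1; unfold minus, plus, opp; simpl; lra.
    + intros x Hx. apply Hc. lra.
  - apply RInt_subset; auto; lra.
Qed.

(** Minimum principle in integral form: with [c] the minimum of [V] on a circle,
    [c^3 - ([c - V]_+)^3] is again nonnegative and superharmonic, and its circle
    averages, which cannot decrease, start at the largest possible value. *)
Lemma positive_superharmonic_bounded_below T V Vx Vxx Vy Vyy :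
  C2_beyond T V Vx Vxx Vy Vyy ->
  (forall x y, T < x -> V x (y + 2 * PI) = V x y) ->
  (forall x y, T < x -> 0 < V x y) ->
  (forall x y, T < x -> 0 <= - (Vxx x y + Vyy x y)) ->
  exists c, 0 < c /\
    forall x y, T + 1 <= x -> - (3 * PI) < y < 3 * PI -> c <= V x y.
Proof.
  intros HV Hper Hpos Hh. destruct HV as [V0 V1 V2 V3 V4 V5 V6 V7 V8].
  destruct (continuity_ab_min (V (T + 1)) (- (3 * PI)) (3 * PI)) as [m [Hm Hmr]].
  { apply circ_bounds. }
  { intros y _. apply continuity_pt_filterlim, (continuity_2d_pt_snd V), V0. lra. }
  set (c := V (T + 1) m). assert (Hc : 0 < c) by (apply Hpos; lra).
  exists c. split; [exact Hc|].
  set (p := fun x y => ppart (c - V x y)).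
  assert (Cp : continuous_beyond T p).
  { apply continuous_beyond_comp; [apply continuous_ppart|cont_beyond]. }
  assert (Dp : forall n (f : R -> R) f' z, is_derive f z f' ->
     is_derive (fun t => ppart (c - f t) ^ S (S n)) z
       (- (INR (S (S n)) * ppart (c - f z) ^ S n * f'))).
  { intros n f f' z Hf.
    replace (- (INR (S (S n)) * ppart (c - f z) ^ S n * f'))
      with (scal (0 - f') (INR (S (S n)) * ppart (c - f z) ^ S n))
      by (unfold scal; simpl; unfold mult; simpl; ring).
    apply (is_derive_comp (fun t => ppart t ^ S (S n)) (fun t => c - f t)).
    - apply is_derive_ppart_pow.
    - apply (is_derive_minus (V := R_NormedModule) (fun _ => c) f); [apply (is_derive_const (V := R_NormedModule))|exact Hf]. }
  assert (D1 : forall (f : R -> R) f' z, is_derive f z f' ->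
     is_derive (fun t => c ^ 3 - ppart (c - f t) ^ 3) z (3 * (ppart (c - f z) ^ 2 * f'))).
  { intros f f' z Hf.
    replace (3 * (ppart (c - f z) ^ 2 * f')) with (0 - - (INR 3 * ppart (c - f z) ^ 2 * f'))
      by (simpl INR; ring).
    apply (is_derive_minus (V := R_NormedModule) (fun _ => c ^ 3));
      [apply (is_derive_const (V := R_NormedModule))|apply (Dp 1%nat), Hf]. }
  assert (D2 : forall (f g : R -> R) f'' z, is_derive f z (g z) -> is_derive g z f'' ->
     is_derive (fun t => 3 * (ppart (c - f t) ^ 2 * g t)) z
       (3 * (ppart (c - f z) ^ 2 * f'') - 6 * (ppart (c - f z) * (g z * g z)))).
  { intros f g f'' z Hf Hg.
    replace (3 * (ppart (c - f z) ^ 2 * f'') - 6 * (ppart (c - f z) * (g z * g z)))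
      with (3 * (- (INR 2 * ppart (c - f z) ^ 1 * g z) * g z + ppart (c - f z) ^ 2 * f''))
      by (simpl INR; ring).
    apply is_derive_scal.
    apply (is_derive_mult (K := R_AbsRing) (fun t => ppart (c - f t) ^ 2) g).
    - apply (Dp 0%nat), Hf.
    - exact Hg.
    - intros; apply Rmult_comm. }
  assert (Hcp : forall n, continuous_beyond T (fun x y => ppart (c - V x y) ^ n)).
  { intros n. induction n as [|n IH]; simpl; cont_beyond. }
  assert (HZ : C2_beyond T (fun x y => c ^ 3 - ppart (c - V x y) ^ 3)
     (fun x y => 3 * (ppart (c - V x y) ^ 2 * Vx x y))
     (fun x y => 3 * (ppart (c - V x y) ^ 2 * Vxx x y) - 6 * (ppart (c - V x y) * (Vx x y * Vx x y)))
     (fun x y => 3 * (ppart (c - V x y) ^ 2 * Vy x y))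
     (fun x y => 3 * (ppart (c - V x y) ^ 2 * Vyy x y) - 6 * (ppart (c - V x y) * (Vy x y * Vy x y)))).
  { split; cont_beyond; try apply Hcp; try exact Cp; intros x y Hx.
    - apply (D1 (fun t => V t y)). apply V5, Hx.
    - apply (D2 (fun t => V t y) (fun t => Vx t y)); [apply V5, Hx|apply V6, Hx].
    - apply (D1 (V x)). apply V7, Hx.
    - apply (D2 (V x) (Vy x)); [apply V7, Hx|apply V8, Hx]. }
  assert (Hpc : forall x y, T < x -> 0 <= p x y <= c).
  { intros x y Hx. split; [apply ppart_ge_0|].
    apply Rmax_lub; [|lra]. assert (H := Hpos x y Hx). lra. }
  assert (Inc : forall x, T + 1 <= x ->
     circ (fun x y => c ^ 3 - ppart (c - V x y) ^ 3) (T + 1)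
     <= circ (fun x y => c ^ 3 - ppart (c - V x y) ^ 3) x).
  { intros x Hx. apply (circ_increasing T _ _ _ _ _ HZ); try lra.
    - intros u y Hu. rewrite Hper by exact Hu. reflexivity.
    - intros u y Hu. assert (p u y ^ 3 <= c ^ 3) by (apply pow_incr, Hpc, Hu).
      unfold p in *. lra.
    - intros u y Hu. assert (H1 := Hh u y Hu). assert (H2 := ppart_ge_0 (c - V u y)).
      assert (H3 := pow2_ge_0 (ppart (c - V u y))).
      assert (H4 := Rle_0_sqr (Vx u y)). assert (H5 := Rle_0_sqr (Vy u y)). unfold Rsqr in *.
      assert (H6 : 0 <= ppart (c - V u y) ^ 2 * - (Vxx u y + Vyy u y)) by (apply Rmult_le_pos; assumption).
      assert (H7 : 0 <= ppart (c - V u y) * (Vx u y * Vx u y)) by (apply Rmult_le_pos; assumption).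
      assert (H8 : 0 <= ppart (c - V u y) * (Vy u y * Vy u y)) by (apply Rmult_le_pos; assumption).
      lra. }
  assert (Split : forall x, T < x ->
     circ (fun x y => c ^ 3 - ppart (c - V x y) ^ 3) x
     = circ (fun _ _ => c ^ 3) x - circ (fun x y => ppart (c - V x y) ^ 3) x).
  { intros x Hx. unfold circ.
    apply (RInt_minus (V := R_CompleteNormedModule) (fun _ => c ^ 3) (fun y => ppart (c - V x y) ^ 3)).
    - apply (ex_RInt_const (V := R_NormedModule)).
    - apply (continuous_beyond_ex_RInt T (fun x y => ppart (c - V x y) ^ 3)); [apply Hcp|exact Hx]. }
  intros x y Hx Hy. apply Rnot_lt_le. intros Hlt.
  assert (H0 : circ (fun x y => ppart (c - V x y) ^ 3) (T + 1) = 0).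
  { unfold circ. rewrite (RInt_ext _ (fun _ => 0)).
    - rewrite (RInt_const (V := R_CompleteNormedModule)). apply Rmult_0_r.
    - intros t Ht. rewrite Rmin_left, Rmax_right in Ht by apply circ_bounds.
      rewrite ppart_neg; [simpl; ring|].
      assert (H := Hm t ltac:(lra)). unfold c. lra. }
  assert (H1 : 0 < circ (fun x y => ppart (c - V x y) ^ 3) x).
  { apply (RInt_pos_of_pos_at _ _ _ y Hy).
    - intros t _. apply (continuity_2d_pt_snd (fun x y => ppart (c - V x y) ^ 3)), Hcp. lra.
    - intros t _. apply pow_le, ppart_ge_0.
    - apply pow_lt. rewrite ppart_pos; lra. }
  assert (H2 := Inc x Hx). rewrite !Split in H2 by lra.
  assert (H3 : circ (fun _ _ => c ^ 3) x = circ (fun _ _ => c ^ 3) (T + 1)) by reflexivity.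
  lra.
Qed.

(** * A continuous function attains its maximum on a rectangle *)

(** The maximum over each vertical segment is a continuous function of its
    abscissa, by uniform continuity, so the one-dimensional theorem applies twice.
    Clamping the abscissa to [[a, b]] makes that function total. *)
Lemma continuity_2d_attains_max F a b c d :
  a <= b -> c <= d ->
  (forall x y, a <= x <= b -> c <= y <= d -> continuity_2d_pt F x y) ->
  exists xm ym, a <= xm <= b /\ c <= ym <= d /\
    forall x y, a <= x <= b -> c <= y <= d -> F x y <= F xm ym.
Proof.
  intros ab cd HF.
  assert (clamp : forall x, a <= Rmax a (Rmin b x) <= b).
  { intros x. split; [apply Rmax_l|]. apply Rmax_lub; [exact ab|apply Rmin_l]. }
  assert (clamp_id : forall x, a <= x <= b -> Rmax a (Rmin b x) = x).
  { intros x Hx. rewrite Rmin_right, Rmax_right; lra. }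
  assert (Hy : forall x, exists ym, c <= ym <= d /\
     forall y, c <= y <= d -> F (Rmax a (Rmin b x)) y <= F (Rmax a (Rmin b x)) ym).
  { intros x. destruct (continuity_ab_maj (F (Rmax a (Rmin b x))) c d cd) as [ym [H1 H2]].
    - intros y Hyr. apply continuity_pt_filterlim, (continuity_2d_pt_snd F).
      apply HF; [apply clamp|exact Hyr].
    - exists ym. auto. }
  set (m := fun x => proj1_sig (constructive_indefinite_description _ (Hy x))).
  assert (Hm : forall x, c <= m x <= d /\
     forall y, c <= y <= d -> F (Rmax a (Rmin b x)) y <= F (Rmax a (Rmin b x)) (m x)).
  { intros x. unfold m. apply proj2_sig. }
  destruct (continuity_ab_maj (fun x => F (Rmax a (Rmin b x)) (m x)) a b ab) as [xm [H1 H2]].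
  - intros x Hx. apply continuity_pt_filterlim, filterlim_locally. intros eps.
    destruct (uniform_continuity_2d F a b c d HF eps) as [del Hdel].
    exists del. intros t Ht. change (Rabs (t - x) < del) in Ht.
    change (Rabs (F (Rmax a (Rmin b t)) (m t) - F (Rmax a (Rmin b x)) (m x)) < eps).
    assert (Hct : Rabs (Rmax a (Rmin b t) - Rmax a (Rmin b x)) < del).
    { rewrite (clamp_id x Hx). revert Ht. unfold Rmax, Rmin.
      destruct (Rle_dec b t); destruct (Rle_dec a _); unfold Rabs;
        repeat destruct Rcase_abs; lra. }
    assert (Hself : forall y, Rabs (y - y) < del).
    { intros y. rewrite Rminus_diag_eq, Rabs_R0 by reflexivity. apply cond_pos. }
    destruct (Hm t) as [Mt1 Mt2]. destruct (Hm x) as [Mx1 Mx2].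
    assert (A1 := Hdel _ _ _ _ (clamp x) Mt1 (clamp t) Mt1 Hct (Hself _)).
    assert (A2 := Hdel _ _ _ _ (clamp x) Mx1 (clamp t) Mx1 Hct (Hself _)).
    assert (A3 := Mt2 _ Mx1). assert (A4 := Mx2 _ Mt1).
    apply Rabs_def2 in A1. apply Rabs_def2 in A2. apply Rabs_def1; lra.
  - exists xm, (m xm). destruct (Hm xm) as [M1 M2]. split; [exact H2|]. split; [exact M1|].
    intros x y Hx Hyr.
    assert (B := H1 x Hx). rewrite (clamp_id x Hx) in B.
    destruct (Hm x) as [_ M3]. rewrite (clamp_id x Hx) in M3.
    assert (B2 := M3 y Hyr). rewrite (clamp_id xm H2) in B. lra.
Qed.

(** * The linear bound on the cylinder *)

Lemma ln_2_le_1 : ln 2 <= 1.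
Proof. assert (H := exp_ineq1_le 1). rewrite <- (ln_exp 1). apply ln_le; lra. Qed.

(** The signed distance, in the maximum norm, to the boundary of the square of
    half-side 1 about [(t0, th0)]. *)
Definition weight (t0 th0 x y : R) : R :=
  Rmin (1 - Rabs (x - t0)) (1 - Rabs (y - th0)).

Lemma continuous_beyond_weight T t0 th0 : continuous_beyond T (weight t0 th0).
Proof.
  set (p := fun x (_ : R) => 1 - Rabs (x - t0)).
  set (q := fun (_ y : R) => 1 - Rabs (y - th0)).
  assert (Cp : continuous_beyond T p).
  { apply continuous_beyond_minus; [apply continuous_beyond_const|].
    apply continuous_beyond_comp; [apply continuous_Rabs|].
    intros x y _. apply continuity_2d_pt_minus; [apply continuity_2d_pt_id1|apply continuity_2d_pt_const]. }
  assert (Cq : continuous_beyond T q).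
  { apply continuous_beyond_minus; [apply continuous_beyond_const|].
    apply continuous_beyond_comp; [apply continuous_Rabs|].
    intros x y _. apply continuity_2d_pt_minus; [apply continuity_2d_pt_id2|apply continuity_2d_pt_const]. }
  intros x y Hx.
  apply continuity_2d_pt_ext with (fun x y => p x y - ppart (p x y - q x y)).
  - intros u v. unfold weight, ppart. fold (p u v) (q u v). unfold Rmax, Rmin.
    destruct (Rle_dec (p u v - q u v) 0); destruct (Rle_dec (p u v) (q u v)); lra.
  - apply continuity_2d_pt_minus; [apply Cp, Hx|].
    apply (continuous_beyond_comp T ppart (fun x y => p x y - q x y)); [apply continuous_ppart| |exact Hx].
    cont_beyond.
Qed.

Lemma weight_pos t0 th0 x y :
  0 < weight t0 th0 x y -> t0 - 1 < x < t0 + 1 /\ th0 - 1 < y < th0 + 1.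
Proof.
  unfold weight. intros H.
  assert (H1 := Rmin_l (1 - Rabs (x - t0)) (1 - Rabs (y - th0))).
  assert (H2 := Rmin_r (1 - Rabs (x - t0)) (1 - Rabs (y - th0))).
  assert (A1 : Rabs (x - t0) < 1) by lra. assert (A2 : Rabs (y - th0) < 1) by lra.
  apply Rabs_def2 in A1. apply Rabs_def2 in A2. lra.
Qed.

Lemma weight_le_1 t0 th0 x y : weight t0 th0 x y <= 1.
Proof.
  assert (H1 := Rmin_l (1 - Rabs (x - t0)) (1 - Rabs (y - th0))).
  assert (H2 := Rabs_pos (x - t0)). unfold weight. lra.
Qed.

Lemma weight_lipschitz t0 th0 x y x' y' r :
  Rabs (x' - x) <= r -> Rabs (y' - y) <= r ->
  weight t0 th0 x y - r <= weight t0 th0 x' y'.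
Proof.
  intros Hx Hy. unfold weight.
  assert (H1 := Rmin_l (1 - Rabs (x - t0)) (1 - Rabs (y - th0))).
  assert (H2 := Rmin_r (1 - Rabs (x - t0)) (1 - Rabs (y - th0))).
  assert (T1 := Rabs_triang (x' - x) (x - t0)). assert (T2 := Rabs_triang (y' - y) (y - th0)).
  replace (x' - x + (x - t0)) with (x' - t0) in T1 by ring.
  replace (y' - y + (y - th0)) with (y' - th0) in T2 by ring.
  apply Rmin_glb; lra.
Qed.

Section Cylinder.
Variables (T : R) (V Vx Vxx Vy Vyy : R -> R -> R).
Hypothesis HV : C2_beyond T V Vx Vxx Vy Vyy.

Let h x y := - (Vxx x y + Vyy x y).

Hypothesis V_pos : forall x y, T < x -> 0 < V x y.
Hypothesis h_ge_0 : forall x y, T < x -> 0 <= h x y.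

(** The centre estimate at the scale [tau = e^(-K M / 2) / 3], where
    [M = V x1 y1], followed by the comparison of the scales [tau] and 1. The source
    term [A tau^2] is then a constant and the logarithm is at most [K M + 9]; the
    bound on [eps] is [54 K eps <= 4 / 9], so that the left-hand side [8 / 9 M]
    absorbs [54 K M eps]; and [2916 = 54 * 24 * 9 / 4]. *)
Lemma value_le_average_of_small_mass K x1 y1 eps :
  0 < K -> T < x1 - 1 ->
  (forall x y, x1 - exp (- (K * V x1 y1) / 2) / 3 <= x <= x1 + exp (- (K * V x1 y1) / 2) / 3 ->
     y1 - exp (- (K * V x1 y1) / 2) / 3 <= y <= y1 + exp (- (K * V x1 y1) / 2) / 3 ->
     h x y <= 4 * K * exp (K * V x1 y1)) ->
  square_int x1 y1 1 h <= eps -> 243 * K * eps <= 2 ->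
  V x1 y1 <= 2916 * square_int x1 y1 1 V + 9 / K + 12 * K.
Proof.
  intros HK Hx1 Hh Hm He.
  set (M := V x1 y1) in *. assert (HM : 0 < M) by (apply V_pos; lra).
  set (tau := exp (- (K * M) / 2) / 3) in *.
  assert (Ht0 : 0 < tau) by (apply Rdiv_lt_0_compat; [apply exp_pos|lra]).
  assert (Ht1 : tau <= 1 / 3).
  { unfold tau. apply Rmult_le_compat_r; [lra|]. rewrite <- exp_0. apply Rlt_le, exp_increasing. nra. }
  assert (Htt : tau * tau = exp (- (K * M)) / 9).
  { unfold tau. replace (exp (- (K * M))) with (exp (- (K * M) / 2) * exp (- (K * M) / 2)).
    - field.
    - rewrite <- exp_plus. f_equal. field. }
  assert (Htt0 : 0 < tau * tau) by nra.
  assert (HAt : 12 * (4 * K * exp (K * M)) * (tau * tau) = 16 / 3 * K).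
  { rewrite Htt. replace (12 * (4 * K * exp (K * M)) * (exp (- (K * M)) / 9))
      with (16 / 3 * K * (exp (K * M) * exp (- (K * M)))) by field.
    rewrite <- exp_plus, Rplus_opp_r, exp_0. ring. }
  assert (Hlog : ln (1 * 1 + tau * tau) - ln (tau * tau) <= K * M + 9).
  { assert (ln (1 * 1 + tau * tau) <= ln 2) by (apply ln_le; nra).
    assert (ln (tau * tau) = - (K * M) - ln 9).
    { rewrite Htt. unfold Rdiv. rewrite ln_mult, ln_exp, ln_Rinv; try lra. }
    assert (ln 9 <= 8).
    { rewrite <- (ln_exp 8). apply ln_le; [lra|]. assert (H8 := exp_ineq1_le 8). lra. }
    assert (H2 := ln_2_le_1). lra. }
  assert (Hh0 : 0 <= square_int x1 y1 1 h).
  { apply (DInt_ge_0 T); try lra.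
    - apply (continuous_beyond_source T V Vx Vxx Vy Vyy HV).
    - intros x y Hx _. apply h_ge_0. lra. }
  assert (E1 := center_value_le_square_average T V Vx Vxx Vy Vyy HV x1 y1 tau Ht0 ltac:(lra)
    ltac:(intros; apply Rlt_le, V_pos; lra) (4 * K * exp (K * M))
    ltac:(intros x y Hx Hy; split; [apply h_ge_0; lra|apply Hh; assumption])).
  assert (E2 := small_square_average_le_mass T V Vx Vxx Vy Vyy HV x1 y1 1 ltac:(lra) ltac:(lra)
    ltac:(intros; apply Rlt_le, V_pos; lra) tau ltac:(lra)
    ltac:(intros; apply h_ge_0; lra)).
  fold M in E1. fold h in E2. rewrite HAt in E1.
  set (S := square_int x1 y1 1 V) in *. set (S' := square_int x1 y1 tau V) in *.
  set (m := square_int x1 y1 1 h) in *.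
  set (lg := ln (1 * 1 + tau * tau) - ln (tau * tau)) in *.
  assert (E3 : 24 / (tau * tau) * S' <= 54 * (24 * S + (K * M + 9) * m)).
  { replace (24 / (tau * tau) * S') with (54 * (4 / (9 * (tau * tau)) * S')) by (field; lra).
    apply Rmult_le_compat_l; [lra|]. apply Rle_trans with (1 := E2).
    replace (24 / (1 * 1)) with 24 by field.
    apply Rplus_le_compat_l. apply Rmult_le_compat_r; assumption. }
  assert (E4 : (K * M + 9) * m <= (K * M + 9) * (2 / (243 * K))).
  { apply Rmult_le_compat_l; [nra|].
    apply Rle_trans with (1 := Hm).
    apply (Rmult_le_reg_l (243 * K)); [lra|].
    replace (243 * K * (2 / (243 * K))) with 2 by (field; lra). exact He. }
  assert (E5 : 54 * ((K * M + 9) * (2 / (243 * K))) = 4 / 9 * M + 4 / K) by (field; lra).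
  assert (E6 : 9 / K = 9 / 4 * (4 / K)) by (field; lra).
  lra.
Qed.

Hypothesis V_periodic : forall x y, T < x -> V x (y + 2 * PI) = V x y.

(** The maximizer [(x1, y1)] of [weight^2 e^(K V)] provides a point where [V] is at
    least as large as at the given point and around which [- Lap V] is at most four
    times its bound [K e^(K V)] at the point itself. *)
Theorem cylinder_linear_bound K :
  0 < K ->
  (forall x y, T < x -> - (3 * PI) < y < 3 * PI -> h x y <= K * exp (K * V x y)) ->
  exists C T', forall x y, T' <= x -> - PI <= y <= PI -> V x y <= C * x.
Proof.
  intros HK HhK.
  assert (HPI : 2 < PI) by (assert (H := PI2_1); lra).
  assert (Cc := C2_cont _ _ _ _ _ _ HV).
  assert (Heps : 0 < 2 / (243 * K)) by (apply Rdiv_lt_0_compat; lra).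
  assert (V_ge_0 : forall x y, T < x -> 0 <= V x y) by (intros; apply Rlt_le, V_pos; assumption).
  destruct (source_mass_vanishes T V Vx Vxx Vy Vyy HV V_periodic V_ge_0 h_ge_0 _ Heps) as [T1 [HT1 Hmass]].
  set (al := circ V T1). set (be := circ Vx T1).
  assert (Hal : 0 <= al) by (apply (circ_ge_0 T V Vx Vxx Vy Vyy HV V_ge_0); lra).
  assert (Hbe : 0 <= be) by (apply (circ_slope_ge_0 T V Vx Vxx Vy Vyy HV V_periodic V_ge_0 h_ge_0); lra).
  assert (Hsq : forall x1 y1, T1 <= x1 - 1 -> - (3 * PI) <= y1 - 1 -> y1 + 1 <= 3 * PI ->
     square_int x1 y1 1 V <= 2 * (al + be * (x1 + 1 - T1))).
  { intros x1 y1 Hx1 Hy1 Hy2.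
    apply Rle_trans with (DInt (x1 - 1) (x1 + 1) (- (3 * PI)) (3 * PI) V).
    - apply (DInt_subset T); auto; try lra. intros x y Hx _. apply V_ge_0. lra.
    - apply Rle_trans with (RInt (fun _ => al + be * (x1 + 1 - T1)) (x1 - 1) (x1 + 1)).
      + apply RInt_le; [lra| | |].
        * apply (continuous_beyond_ex_DInt T); auto; try lra.
        * apply (ex_RInt_const (V := R_NormedModule)).
        * intros x Hx.
          apply Rle_trans with (al + be * (x - T1)).
          -- apply (circ_linear_growth T V Vx Vxx Vy Vyy HV V_periodic h_ge_0); lra.
          -- nra.
      + rewrite (RInt_const (V := R_CompleteNormedModule)). right.
        change ((x1 + 1 - (x1 - 1)) * (al + be * (x1 + 1 - T1)) = 2 * (al + be * (x1 + 1 - T1))).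
        ring. }
  set (a0 := 5832 * (al + be * (2 + Rabs T1)) + 9 / K + 12 * K).
  assert (Ha0 : 0 <= a0).
  { assert (0 < 9 / K) by (apply Rdiv_lt_0_compat; lra).
    assert (0 <= be * (2 + Rabs T1)) by (apply Rmult_le_pos; [lra|]; assert (Habs := Rabs_pos T1); lra).
    unfold a0. lra. }
  exists (a0 + 5832 * be), (Rmax 1 (T1 + 2)). intros t0 th0 Ht Hth.
  assert (Ht1 := Rle_trans _ _ _ (Rmax_l _ _) Ht). assert (Ht2 := Rle_trans _ _ _ (Rmax_r _ _) Ht).
  set (Phi := fun x y => weight t0 th0 x y ^ 2 * exp (K * V x y)).
  destruct (continuity_2d_attains_max Phi (t0 - 1) (t0 + 1) (th0 - 1) (th0 + 1))
    as (x1 & y1 & Hx1 & Hy1 & Hmax); try lra.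
  { intros x y Hx _. unfold Phi.
    apply (continuous_beyond_mult T (fun x y => weight t0 th0 x y ^ 2) (fun x y => exp (K * V x y))); [| |lra].
    - assert (Hw := continuous_beyond_weight T t0 th0). simpl. cont_beyond.
    - apply continuous_beyond_comp; [|cont_beyond].
      intros z. apply (ex_derive_continuous (V := R_NormedModule)). exists (exp z). apply is_derive_exp. }
  set (d0 := weight t0 th0 x1 y1) in *. set (M := V x1 y1) in *.
  assert (HM : 0 < M) by (apply V_pos; lra).
  assert (Hp : exp (K * V t0 th0) <= d0 ^ 2 * exp (K * M)).
  { assert (H := Hmax t0 th0 ltac:(lra) ltac:(lra)). unfold Phi in H. fold d0 M in H.
    replace (weight t0 th0 t0 th0) with 1 in H; [lra|].
    unfold weight. rewrite (Rminus_diag_eq t0 t0), (Rminus_diag_eq th0 th0), Rabs_R0 by reflexivity.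
    rewrite Rmin_left by lra. ring. }
  assert (Hd0 : 0 < d0).
  { assert (Hw : 0 <= d0).
    { unfold d0, weight. apply Rmin_glb; assert (H9 : forall z w, w - 1 <= z <= w + 1 -> 0 <= 1 - Rabs (z - w));
      try (intros z w Hz; assert (Rabs (z - w) <= 1) by (apply Rabs_le; lra); lra);
      apply H9; lra. }
    destruct Hw as [Hw|Hw]; [exact Hw|].
    assert (H := exp_pos (K * V t0 th0)). rewrite <- Hw in Hp. simpl in Hp. lra. }
  assert (Hin := weight_pos _ _ _ _ Hd0). assert (Hd1 : d0 <= 1) by apply weight_le_1.
  assert (HVM : V t0 th0 <= M).
  { apply Rnot_lt_le. intros Hlt.
    assert (exp (K * M) < exp (K * V t0 th0)) by (apply exp_increasing, Rmult_lt_compat_l; assumption).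
    assert (H1 := exp_pos (K * M)). assert (d0 ^ 2 <= 1) by (simpl; nra). nra. }
  set (tau := exp (- (K * M) / 2) / 3).
  assert (Ht0 : 0 < tau) by (apply Rdiv_lt_0_compat; [apply exp_pos|lra]).
  (* otherwise the maximum of Phi would be below 1, but Phi exceeds 1 at the centre *)
  assert (Htau : tau <= d0 / 2).
  { apply Rnot_lt_le. intros Hlt.
    assert (H1 : 1 < exp (K * V t0 th0)).
    { rewrite <- exp_0. apply exp_increasing. apply Rmult_lt_0_compat; [exact HK|]. apply V_pos. lra. }
    assert (H2 : exp (- (K * M) / 2) * exp (- (K * M) / 2) * exp (K * M) = 1).
    { rewrite <- !exp_plus. replace (- (K * M) / 2 + - (K * M) / 2 + K * M) with 0 by field. apply exp_0. }
    assert (H3 : d0 ^ 2 <= 4 * (tau * tau)) by (simpl; nra).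
    assert (H4 := exp_pos (K * M)).
    assert (H5 : 4 * (tau * tau) * exp (K * M) = 4 / 9).
    { unfold tau. rewrite <- (Rmult_1_r (4 / 9)), <- H2. field. }
    nra. }
  assert (HB : V x1 y1 <= 2916 * square_int x1 y1 1 V + 9 / K + 12 * K).
  { apply (value_le_average_of_small_mass K x1 y1 (2 / (243 * K))); try lra.
    - fold M. fold tau. intros x y Hx Hy.
      assert (Hw := weight_lipschitz t0 th0 x1 y1 x y tau
        ltac:(apply Rabs_le; lra) ltac:(apply Rabs_le; lra)).
      fold d0 in Hw.
      assert (Hw2 : d0 / 2 <= weight t0 th0 x y) by lra.
      assert (Hxy := weight_pos t0 th0 x y ltac:(lra)).
      assert (HF := Hmax x y ltac:(lra) ltac:(lra)). unfold Phi in HF. fold d0 M in HF.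
      apply Rle_trans with (1 := HhK x y ltac:(lra) ltac:(lra)).
      replace (4 * K * exp (K * M)) with (K * (4 * exp (K * M))) by ring.
      apply Rmult_le_compat_l; [lra|].
      assert (H1 := exp_pos (K * V x y)).
      assert (H2 : (d0 / 2) ^ 2 <= weight t0 th0 x y ^ 2) by (apply pow_incr; lra).
      assert (H3 : 0 < d0 ^ 2) by (apply pow_lt; exact Hd0).
      apply (Rmult_le_reg_l (d0 ^ 2)); [exact H3|].
      replace ((d0 / 2) ^ 2) with (d0 ^ 2 / 4) in H2 by field.
      assert (d0 ^ 2 / 4 * exp (K * V x y) <= weight t0 th0 x y ^ 2 * exp (K * V x y))
        by (apply Rmult_le_compat_r; lra).
      lra.
    - apply Rle_trans with (DInt (x1 - 1) (x1 + 1) (- (3 * PI)) (3 * PI) h).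
      + apply (DInt_subset T); try lra.
        * apply (continuous_beyond_source T V Vx Vxx Vy Vyy HV).
        * intros x y Hx _. apply h_ge_0. lra.
      + apply Hmass; lra.
    - right. field. lra. }
  assert (HS := Hsq x1 y1 ltac:(lra) ltac:(lra) ltac:(lra)).
  fold M in HB.
  assert (Hlin : be * (x1 + 1 - T1) <= be * (2 + Rabs T1) + be * t0).
  { rewrite <- Rmult_plus_distr_l. apply Rmult_le_compat_l; [exact Hbe|].
    assert (H := Rle_abs (- T1)). rewrite Rabs_Ropp in H. lra. }
  assert (HMa : M <= a0 + 5832 * be * t0) by (unfold a0; lra).
  nra.
Qed.

End Cylinder.

(** * Logarithmic polar coordinates *)

Definition plane_x (t th : R) : R := exp (- t) * cos th.
Definition plane_y (t th : R) : R := exp (- t) * sin th.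
Definition log_polar (w : R -> R -> R) (t th : R) : R := w (plane_x t th) (plane_y t th).

Definition on_punctured_square (r : R) (P : R -> R -> Prop) : Prop :=
  forall a b, Rabs a < r -> Rabs b < r -> (a, b) <> (0, 0) -> P a b.

Lemma punctured_square_locally r P (a b : R) :
  on_punctured_square r P -> Rabs a < r -> Rabs b < r -> (a, b) <> (0, 0) ->
  locally (a, b) (fun u : R * R => P (fst u) (snd u)).
Proof.
  intros H Ha Hb Hab.
  assert (Hm : 0 < Rmax (Rabs a) (Rabs b)).
  { apply Rnot_le_lt. intros Hle. apply Hab.
    assert (H1 := Rmax_l (Rabs a) (Rabs b)). assert (H2 := Rmax_r (Rabs a) (Rabs b)).
    assert (H3 := Rabs_pos a). assert (H4 := Rabs_pos b).
    f_equal; apply NNPP; intros H5; apply Rabs_pos_lt in H5; lra. }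
  assert (He : 0 < Rmin (Rmax (Rabs a) (Rabs b)) (r - Rmax (Rabs a) (Rabs b))).
  { apply Rmin_pos; [exact Hm|]. assert (Rmax (Rabs a) (Rabs b) < r) by (apply Rmax_lub_lt; assumption). lra. }
  exists (mkposreal _ He). intros [a' b'] [H1 H2]. change R in a', b'.
  change (Rabs (a' - a) < Rmin (Rmax (Rabs a) (Rabs b)) (r - Rmax (Rabs a) (Rabs b))) in H1.
  change (Rabs (b' - b) < Rmin (Rmax (Rabs a) (Rabs b)) (r - Rmax (Rabs a) (Rabs b))) in H2.
  assert (M1 := Rmin_l (Rmax (Rabs a) (Rabs b)) (r - Rmax (Rabs a) (Rabs b))).
  assert (M2 := Rmin_r (Rmax (Rabs a) (Rabs b)) (r - Rmax (Rabs a) (Rabs b))).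
  assert (N1 := Rmax_l (Rabs a) (Rabs b)). assert (N2 := Rmax_r (Rabs a) (Rabs b)).
  assert (T1 := Rabs_triang (a' - a) a). replace (a' - a + a) with a' in T1 by ring.
  assert (T2 := Rabs_triang (b' - b) b). replace (b' - b + b) with b' in T2 by ring.
  apply H; simpl; try lra.
  intros E. injection E as -> ->.
  replace (0 - a) with (- a) in H1 by ring. replace (0 - b) with (- b) in H2 by ring.
  rewrite Rabs_Ropp in H1, H2.
  assert (Rmax (Rabs a) (Rabs b) < Rmax (Rabs a) (Rabs b)) by (apply Rmax_lub_lt; lra).
  lra.
Qed.

(** The mean value theorem handles the increment along the continuous partial
    derivative, and the definition of a derivative the other one. *)
Lemma differentiable_of_continuous_partial f (a b : R) :
  locally (a, b) (fun u : R * R => ex_derive (fun z => f z (snd u)) (fst u)) ->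
  ex_derive (fun z => f a z) b ->
  continuity_2d_pt (fun u v => Derive (fun z => f z v) u) a b ->
  differentiable_pt_lim f a b (Derive (fun z => f z b) a) (Derive (fun z => f a z) b).
Proof.
  intros Hx Hy Hc. apply filterdiff_differentiable_pt_lim.
  apply (is_derive_filterdiff f a b (fun u v => Derive (fun z => f z v) u)).
  - apply (filter_imp (fun u : R * R => ex_derive (fun z => f z (snd u)) (fst u))); [|exact Hx].
    intros u Hu. apply Derive_correct, Hu.
  - apply Derive_correct, Hy.
  - apply continuity_2d_pt_filterlim in Hc. exact Hc.
Qed.

Lemma is_derive_comp_plane f p q z l1 l2 p' q' :
  differentiable_pt_lim f (p z) (q z) l1 l2 ->
  is_derive p z p' -> is_derive q z q' ->
  is_derive (fun t => f (p t) (q t)) z (l1 * p' + l2 * q').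
Proof.
  intros Hf Hp Hq. apply is_derive_Reals.
  apply derivable_pt_lim_comp_2d; [exact Hf| |]; apply is_derive_Reals; assumption.
Qed.

Lemma is_derive_plane_x_t t th : is_derive (fun s => plane_x s th) t (- plane_x t th).
Proof. unfold plane_x. auto_derive; [trivial|ring]. Qed.
Lemma is_derive_plane_y_t t th : is_derive (fun s => plane_y s th) t (- plane_y t th).
Proof. unfold plane_y. auto_derive; [trivial|ring]. Qed.
Lemma is_derive_plane_x_th t th : is_derive (fun s => plane_x t s) th (- plane_y t th).
Proof. unfold plane_x, plane_y. auto_derive; [trivial|ring]. Qed.
Lemma is_derive_plane_y_th t th : is_derive (fun s => plane_y t s) th (plane_x t th).
Proof. unfold plane_x, plane_y. auto_derive; [trivial|ring]. Qed.

Lemma plane_sqr t th :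
  plane_x t th * plane_x t th + plane_y t th * plane_y t th = exp (- (2 * t)).
Proof.
  unfold plane_x, plane_y.
  assert (H := sin2_cos2 th). unfold Rsqr in H.
  replace (exp (- (2 * t))) with (exp (- t) * exp (- t)).
  - transitivity (exp (- t) * exp (- t) * (sin th * sin th + cos th * cos th)); [ring|].
    rewrite H. ring.
  - rewrite <- exp_plus. f_equal. ring.
Qed.

Lemma plane_nonzero t th : (plane_x t th, plane_y t th) <> (0, 0).
Proof.
  intros E. injection E as E1 E2. assert (H := plane_sqr t th). rewrite E1, E2 in H.
  assert (H1 := exp_pos (- (2 * t))). lra.
Qed.

Lemma plane_bound r t th :
  0 < r -> - ln r < t -> Rabs (plane_x t th) < r /\ Rabs (plane_y t th) < r.
Proof.
  intros Hr Ht.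
  assert (He : exp (- t) < r).
  { rewrite <- (exp_ln r Hr). apply exp_increasing. lra. }
  assert (H0 := exp_pos (- t)).
  unfold plane_x, plane_y. rewrite !Rabs_mult, !(Rabs_pos_eq (exp (- t))) by lra.
  assert (Hc : Rabs (cos th) <= 1) by (apply Rabs_le, COS_bound).
  assert (Hs : Rabs (sin th) <= 1) by (apply Rabs_le, SIN_bound).
  split; nra.
Qed.

Lemma continuity_2d_pt_plane t th :
  continuity_2d_pt plane_x t th /\ continuity_2d_pt plane_y t th.
Proof.
  assert (He : continuity_2d_pt (fun s _ => exp (- s)) t th).
  { apply (continuity_1d_2d_pt_comp (fun s => exp (- s)) (fun s _ => s)).
    - apply continuity_pt_filterlim, (ex_derive_continuous (V := R_NormedModule) (fun s => exp (- s)) t).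
      auto_derive. trivial.
    - apply continuity_2d_pt_id1. }
  split; (apply continuity_2d_pt_mult; [exact He|]).
  - apply (continuity_1d_2d_pt_comp cos (fun _ s => s)); [apply continuity_cos|apply continuity_2d_pt_id2].
  - apply (continuity_1d_2d_pt_comp sin (fun _ s => s)); [apply continuity_sin|apply continuity_2d_pt_id2].
Qed.

Lemma log_polar_continuous r F :
  0 < r -> on_punctured_square r (continuity_2d_pt F) ->
  continuous_beyond (- ln r) (log_polar F).
Proof.
  intros Hr HF t th Ht. destruct (plane_bound r t th Hr Ht) as [Hx Hy].
  assert (H := HF _ _ Hx Hy (plane_nonzero t th)).
  destruct (continuity_2d_pt_plane t th) as [Cx Cy].
  apply continuity_2d_pt_filterlim in Cx, Cy, H. apply continuity_2d_pt_filterlim.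
  apply (continuous_comp_2 (fun z : R * R => plane_x (fst z) (snd z))
    (fun z : R * R => plane_y (fst z) (snd z)) F (t, th)); assumption.
Qed.

(** The map [(t, th) -> exp (- t) (cos th, sin th)] is conformal with factor
    [exp (- t)]: in the sum of the pure second derivatives the mixed and the
    first-order terms cancel. *)
Lemma log_polar_C2 r w :
  0 < r -> on_punctured_square r (ex_diff_n w 2) ->
  exists Wx Wxx Wy Wyy,
    C2_beyond (- ln r) (log_polar w) Wx Wxx Wy Wyy /\
    forall t th, Wxx t th + Wyy t th
      = exp (- (2 * t)) * laplacian w (plane_x t th, plane_y t th).
Proof.
  intros Hr Hw.
  set (w1 := fun a b => Derive (fun z => w z b) a).
  set (w2 := fun a b => Derive (fun z => w a z) b).
  set (w11 := fun a b => Derive (fun z => w1 z b) a).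
  set (w12 := fun a b => Derive (fun z => w1 a z) b).
  set (w21 := fun a b => Derive (fun z => w2 z b) a).
  set (w22 := fun a b => Derive (fun z => w2 a z) b).
  set (T := - ln r).
  assert (HC : forall F, on_punctured_square r (continuity_2d_pt F) ->
     continuous_beyond T (fun t th => F (plane_x t th) (plane_y t th))).
  { intros F HF. apply (log_polar_continuous r F Hr HF). }
  assert (CX : continuous_beyond T plane_x) by (intros t th _; apply continuity_2d_pt_plane).
  assert (CY : continuous_beyond T plane_y) by (intros t th _; apply continuity_2d_pt_plane).
  assert (C0 := HC w ltac:(intros a b Ha Hb Hab; apply (Hw a b Ha Hb Hab))).
  assert (C1 := HC w1 ltac:(intros a b Ha Hb Hab; apply (Hw a b Ha Hb Hab))).
  assert (C2 := HC w2 ltac:(intros a b Ha Hb Hab; apply (Hw a b Ha Hb Hab))).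
  assert (C11 := HC w11 ltac:(intros a b Ha Hb Hab; apply (Hw a b Ha Hb Hab))).
  assert (C12 := HC w12 ltac:(intros a b Ha Hb Hab; apply (Hw a b Ha Hb Hab))).
  assert (C21 := HC w21 ltac:(intros a b Ha Hb Hab; apply (Hw a b Ha Hb Hab))).
  assert (C22 := HC w22 ltac:(intros a b Ha Hb Hab; apply (Hw a b Ha Hb Hab))).
  assert (Hdiff : forall F, on_punctured_square r (ex_diff_n F 1) ->
     forall t th, T < t -> differentiable_pt_lim F (plane_x t th) (plane_y t th)
       (Derive (fun z => F z (plane_y t th)) (plane_x t th))
       (Derive (fun z => F (plane_x t th) z) (plane_y t th))).
  { intros F HF t th Ht. destruct (plane_bound r t th Hr Ht) as [Hx Hy].
    assert (Hn := plane_nonzero t th).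
    apply differentiable_of_continuous_partial.
    - apply (punctured_square_locally r (fun a b => ex_derive (fun z => F z b) a)); auto.
      intros a b Ha Hb Hab. apply (HF a b Ha Hb Hab).
    - apply (HF _ _ Hx Hy Hn).
    - apply (HF _ _ Hx Hy Hn). }
  assert (D0 := Hdiff w ltac:(intros a b Ha Hb Hab; destruct (Hw a b Ha Hb Hab) as (? & ? & ? & H1 & H2);
     repeat split; try assumption; [apply H1|apply H2])).
  assert (D1 := Hdiff w1 ltac:(intros a b Ha Hb Hab; apply (Hw a b Ha Hb Hab))).
  assert (D2 := Hdiff w2 ltac:(intros a b Ha Hb Hab; apply (Hw a b Ha Hb Hab))).
  set (X := plane_x) in *. set (Y := plane_y) in *.
  exists (fun t th => w1 (X t th) (Y t th) * - X t th + w2 (X t th) (Y t th) * - Y t th).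
  exists (fun t th =>
    ((w11 (X t th) (Y t th) * - X t th + w12 (X t th) (Y t th) * - Y t th) * - X t th
      + w1 (X t th) (Y t th) * X t th)
    + ((w21 (X t th) (Y t th) * - X t th + w22 (X t th) (Y t th) * - Y t th) * - Y t th
      + w2 (X t th) (Y t th) * Y t th)).
  exists (fun t th => w1 (X t th) (Y t th) * - Y t th + w2 (X t th) (Y t th) * X t th).
  exists (fun t th =>
    ((w11 (X t th) (Y t th) * - Y t th + w12 (X t th) (Y t th) * X t th) * - Y t th
      + w1 (X t th) (Y t th) * - X t th)
    + ((w21 (X t th) (Y t th) * - Y t th + w22 (X t th) (Y t th) * X t th) * X t th
      + w2 (X t th) (Y t th) * - Y t th)).
  split.
  - split; cont_beyond; intros t th Ht.
    + apply (is_derive_comp_plane w (fun s => X s th) (fun s => Y s th));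
        [apply D0, Ht|apply is_derive_plane_x_t|apply is_derive_plane_y_t].
    + apply (is_derive_plus (V := R_NormedModule)).
      * apply (is_derive_mult (K := R_AbsRing) (fun s => w1 (X s th) (Y s th)) (fun s => - X s th)).
        -- apply (is_derive_comp_plane w1 (fun s => X s th) (fun s => Y s th));
             [apply D1, Ht|apply is_derive_plane_x_t|apply is_derive_plane_y_t].
        -- rewrite <- (Ropp_involutive (X t th)). 
           apply (is_derive_opp (V := R_NormedModule) (fun s => X s th)), is_derive_plane_x_t.
        -- intros; apply Rmult_comm.
      * apply (is_derive_mult (K := R_AbsRing) (fun s => w2 (X s th) (Y s th)) (fun s => - Y s th)).
        -- apply (is_derive_comp_plane w2 (fun s => X s th) (fun s => Y s th));
             [apply D2, Ht|apply is_derive_plane_x_t|apply is_derive_plane_y_t].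
        -- rewrite <- (Ropp_involutive (Y t th)).
           apply (is_derive_opp (V := R_NormedModule) (fun s => Y s th)), is_derive_plane_y_t.
        -- intros; apply Rmult_comm.
    + apply (is_derive_comp_plane w (fun s => X t s) (fun s => Y t s));
        [apply D0, Ht|apply is_derive_plane_x_th|apply is_derive_plane_y_th].
    + apply (is_derive_plus (V := R_NormedModule)).
      * apply (is_derive_mult (K := R_AbsRing) (fun s => w1 (X t s) (Y t s)) (fun s => - Y t s)).
        -- apply (is_derive_comp_plane w1 (fun s => X t s) (fun s => Y t s));
             [apply D1, Ht|apply is_derive_plane_x_th|apply is_derive_plane_y_th].
        -- apply (is_derive_opp (V := R_NormedModule) (fun s => Y t s)), is_derive_plane_y_th.
        -- intros; apply Rmult_comm.
      * apply (is_derive_mult (K := R_AbsRing) (fun s => w2 (X t s) (Y t s)) (fun s => X t s)).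
        -- apply (is_derive_comp_plane w2 (fun s => X t s) (fun s => Y t s));
             [apply D2, Ht|apply is_derive_plane_x_th|apply is_derive_plane_y_th].
        -- apply is_derive_plane_x_th.
        -- intros; apply Rmult_comm.
  - intros t th. cbv beta. rewrite <- (plane_sqr t th). unfold X, Y.
    change (laplacian w (plane_x t th, plane_y t th))
      with (w11 (plane_x t th) (plane_y t th) + w22 (plane_x t th) (plane_y t th)).
    ring.
Qed.

Lemma log_polar_periodic w t th : log_polar w t (th + 2 * PI) = log_polar w t th.
Proof.
  unfold log_polar, plane_x, plane_y.
  replace (cos (th + 2 * PI)) with (cos th).
  - replace (sin (th + 2 * PI)) with (sin th); [reflexivity|].
    rewrite <- (sin_period th 1). f_equal. simpl. ring.
  - rewrite <- (cos_period th 1). f_equal. simpl. ring.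
Qed.

Lemma log_polar_surjective a b :
  (a, b) <> (0, 0) ->
  let t := ln (1 / euclidean_norm (a, b)) in
  exists th, - PI <= th <= PI /\ a = plane_x t th /\ b = plane_y t th.
Proof.
  intros Hab t.
  assert (Hs : 0 < a ^ 2 + b ^ 2).
  { assert (H1 := pow2_ge_0 a). assert (H2 := pow2_ge_0 b).
    apply Rnot_le_lt. intros Hle. apply Hab. f_equal; apply NNPP; intros H; apply pow2_gt_0 in H; lra. }
  set (n := euclidean_norm (a, b)) in *.
  assert (Hn : 0 < n) by (apply sqrt_lt_R0; exact Hs).
  assert (Hn2 : n * n = a ^ 2 + b ^ 2) by (apply sqrt_sqrt; simpl; lra).
  assert (Et : exp (- t) = n).
  { unfold t. rewrite <- ln_Rinv by (apply Rdiv_lt_0_compat; lra).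
    rewrite exp_ln; [field; lra|]. apply Rinv_0_lt_compat, Rdiv_lt_0_compat; lra. }
  assert (Hc : -1 <= a / n <= 1).
  { assert (Ha : Rabs a <= n).
    { rewrite <- sqrt_Rsqr_abs. apply sqrt_le_1_alt. unfold Rsqr. simpl. nra. }
    apply Rabs_le_between in Ha.
    split.
    - apply (Rmult_le_reg_r n); [exact Hn|]. replace (a / n * n) with a by (field; lra). lra.
    - apply (Rmult_le_reg_r n); [exact Hn|]. replace (a / n * n) with a by (field; lra). lra. }
  assert (Hsin : sin (acos (a / n)) = Rabs b / n).
  { rewrite sin_acos by exact Hc.
    replace (1 - Rsqr (a / n)) with (Rsqr (Rabs b / n)).
    - apply sqrt_Rsqr. apply Rdiv_le_0_compat; [apply Rabs_pos|exact Hn].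
    - rewrite Rsqr_div', Rsqr_div', <- Rsqr_abs. unfold Rsqr. rewrite Hn2.
      field. lra. }
  assert (HB := acos_bound (a / n)).
  destruct (Rle_dec 0 b) as [Hb|Hb].
  - exists (acos (a / n)). split; [lra|]. unfold plane_x, plane_y.
    rewrite Et, cos_acos, Hsin, Rabs_pos_eq by assumption. split; field; lra.
  - exists (- acos (a / n)). split; [lra|]. unfold plane_x, plane_y.
    rewrite Et, cos_neg, sin_neg, cos_acos, Hsin, Rabs_left by lra. split; field; lra.
Qed.

(** * The system *)

Lemma C2_beyond_plus T V Vx Vxx Vy Vyy W Wx Wxx Wy Wyy :
  C2_beyond T V Vx Vxx Vy Vyy -> C2_beyond T W Wx Wxx Wy Wyy ->
  C2_beyond T (fun x y => V x y + W x y) (fun x y => Vx x y + Wx x y)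
    (fun x y => Vxx x y + Wxx x y) (fun x y => Vy x y + Wy x y)
    (fun x y => Vyy x y + Wyy x y).
Proof.
  intros [V0 V1 V2 V3 V4 V5 V6 V7 V8] [W0 W1 W2 W3 W4 W5 W6 W7 W8].
  split; cont_beyond; intros x y Hx; apply (is_derive_plus (V := R_NormedModule)); auto.
Qed.

Lemma C2_beyond_weaken T T' V Vx Vxx Vy Vyy :
  T <= T' -> C2_beyond T V Vx Vxx Vy Vyy -> C2_beyond T' V Vx Vxx Vy Vyy.
Proof.
  intros HT [V0 V1 V2 V3 V4 V5 V6 V7 V8].
  split; intros x y Hx; (apply V0 || apply V1 || apply V2 || apply V3 || apply V4 ||
    apply V5 || apply V6 || apply V7 || apply V8); lra.
Qed.

(** Growth at infinity controls large arguments and compactness the remaining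
    ones; the values near [0] may be unbounded, hence the condition [c <= s]. *)
Lemma exponential_bound_away_from_0 f c :
  continuous_pos_fun f -> exp_bounded_at_infinity f -> 0 < c ->
  exists K, 0 < K /\ forall s, c <= s -> f s <= K * exp (K * s).
Proof.
  intros Hf [C [M HM]] Hc.
  set (N := Rmax (Rmax M c) 0 + 1).
  assert (HN1 : c <= N /\ M < N /\ 0 < N).
  { assert (H1 := Rmax_l (Rmax M c) 0). assert (H2 := Rmax_r (Rmax M c) 0).
    assert (H3 := Rmax_l M c). assert (H4 := Rmax_r M c). unfold N. lra. }
  destruct (continuity_ab_maj f c N) as [m [Hm Hmr]]; [lra| |].
  { intros s Hs. apply continuity_pt_filterlim, Hf. lra. }
  assert (Hfm : 0 < f m) by (apply Hf; lra).
  assert (HC := Rabs_pos C).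
  exists (1 + Rabs C + f m). split; [lra|].
  set (K := 1 + Rabs C + f m).
  intros s Hs.
  assert (He : 1 <= exp (K * s)).
  { rewrite <- exp_0. apply Rlt_le, exp_increasing. apply Rmult_lt_0_compat; unfold K; lra. }
  destruct (Rle_dec s N) as [HsN|HsN].
  - assert (f s <= f m) by (apply Hm; lra). unfold K in *. nra.
  - assert (Hfs : f s <= exp (K * s)).
    { assert (H := HM s ltac:(lra)). unfold log_plus in H.
      destruct (Rlt_dec 1 (f s)) as [H1|H1]; [|lra].
      rewrite <- (exp_ln (f s)) by lra.
      assert (H2 := Rle_abs (ln (f s))). rewrite (Rabs_pos_eq s) in H by lra.
      assert (H3 := Rle_abs C).
      assert (Hle : ln (f s) <= K * s) by (unfold K; nra).
      destruct Hle as [Hle|Hle]; [apply Rlt_le, exp_increasing, Hle|rewrite Hle; lra]. }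
    unfold K in *. nra.
Qed.

Theorem theorem2p1 (f g : R -> R) (u v : R -> R -> R)
  (hf : continuous_pos_fun f) (hg : continuous_pos_fun g)
  (hfexp : exp_bounded_at_infinity f) (hgexp : exp_bounded_at_infinity g)
  (hu : C2_near_origin u) (hv : C2_near_origin v)
  (hupos : positive_near_origin u) (hvpos : positive_near_origin v)
  (hsys : solves_near_origin f g u v) :
  bigO_log_at_origin u /\ bigO_log_at_origin v.
Proof.
  assert (Hloc : exists r, 0 < r <= 1 /\ on_punctured_square r (fun a b =>
     ex_diff_n u 2 a b /\ ex_diff_n v 2 a b /\ 0 < u a b /\ 0 < v a b /\
     0 <= - laplacian u (a, b) <= f (v a b) /\ 0 <= - laplacian v (a, b) <= g (u a b))).
  { destruct hu as [e1 h1]. destruct hv as [e2 h2]. destruct hupos as [e3 h3].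
    destruct hvpos as [e4 h4]. destruct hsys as [e5 h5].
    assert (p1 := cond_pos e1). assert (p2 := cond_pos e2). assert (p3 := cond_pos e3).
    assert (p4 := cond_pos e4). assert (p5 := cond_pos e5).
    set (r := Rmin 1 (Rmin e1 (Rmin e2 (Rmin e3 (Rmin e4 e5))))).
    assert (Hr : 0 < r) by (repeat apply Rmin_pos; lra).
    assert (Hle : r <= 1 /\ r <= e1 /\ r <= e2 /\ r <= e3 /\ r <= e4 /\ r <= e5).
    { unfold r, Rmin. repeat destruct Rle_dec; lra. }
    exists r. split; [lra|]. intros a b Ha Hb Hab.
    assert (Hball : forall e : posreal, r <= e -> ball (0, 0) e (a, b)).
    { intros e He. split; (apply Rlt_le_trans with (2 := He));
        [replace a with (minus a 0) in Ha|replace b with (minus b 0) in Hb];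
        try assumption; unfold minus, plus, opp; simpl; ring. }
    destruct (h5 (a, b)) as [H5 H6]; [apply Hball; lra|exact Hab|].
    split; [apply (h1 (a, b)); [apply Hball; lra|exact Hab]|].
    split; [apply (h2 (a, b)); [apply Hball; lra|exact Hab]|].
    split; [apply (h3 (a, b)); [apply Hball; lra|exact Hab]|].
    split; [apply (h4 (a, b)); [apply Hball; lra|exact Hab]|].
    split; [exact H5|exact H6]. }
  destruct Hloc as (r & Hr & Hall).
  set (T := - ln r).
  assert (HT : 0 <= T).
  { assert (ln r <= 0) by (rewrite <- ln_1; apply ln_le; lra). unfold T. lra. }
  destruct (log_polar_C2 r u ltac:(lra)) as (Ux & Uxx & Uy & Uyy & HU & LU).
  { intros a b Ha Hb Hab. apply (Hall a b Ha Hb Hab). }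
  destruct (log_polar_C2 r v ltac:(lra)) as (Vx & Vxx & Vy & Vyy & HV & LV).
  { intros a b Ha Hb Hab. apply (Hall a b Ha Hb Hab). }
  assert (Hat : forall t th, T < t ->
     0 < log_polar u t th /\ 0 < log_polar v t th /\
     0 <= - laplacian u (plane_x t th, plane_y t th) <= f (log_polar v t th) /\
     0 <= - laplacian v (plane_x t th, plane_y t th) <= g (log_polar u t th)).
  { intros t th Ht. destruct (plane_bound r t th ltac:(lra) Ht) as [Hx Hy].
    apply (Hall _ _ Hx Hy (plane_nonzero t th)). }
  assert (Hexp : forall t, T < t -> 0 < exp (- (2 * t)) <= 1).
  { intros t Ht. split; [apply exp_pos|]. rewrite <- exp_0. apply Rlt_le, exp_increasing. lra. }
  assert (SU : forall t th, T < t ->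
     0 <= - (Uxx t th + Uyy t th) <= - laplacian u (plane_x t th, plane_y t th)).
  { intros t th Ht. rewrite LU. destruct (Hat t th Ht) as (_ & _ & H & _).
    assert (He := Hexp t Ht). split; nra. }
  assert (SV : forall t th, T < t ->
     0 <= - (Vxx t th + Vyy t th) <= - laplacian v (plane_x t th, plane_y t th)).
  { intros t th Ht. rewrite LV. destruct (Hat t th Ht) as (_ & _ & _ & H).
    assert (He := Hexp t Ht). split; nra. }
  destruct (positive_superharmonic_bounded_below T _ _ _ _ _ HU) as (cu & Hcu & Lu).
  { intros; apply log_polar_periodic. }
  { intros x y Hx. apply (Hat x y Hx). }
  { intros x y Hx. apply SU, Hx. }
  destruct (positive_superharmonic_bounded_below T _ _ _ _ _ HV) as (cv & Hcv & Lv).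
  { intros; apply log_polar_periodic. }
  { intros x y Hx. apply (Hat x y Hx). }
  { intros x y Hx. apply SV, Hx. }
  destruct (exponential_bound_away_from_0 f cv hf hfexp Hcv) as (Kf & HKf & Bf).
  destruct (exponential_bound_away_from_0 g cu hg hgexp Hcu) as (Kg & HKg & Bg).
  destruct (cylinder_linear_bound (T + 1) _ _ _ _ _
     (C2_beyond_weaken T (T + 1) _ _ _ _ _ ltac:(lra) (C2_beyond_plus _ _ _ _ _ _ _ _ _ _ _ HU HV)))
    with (K := Kf + Kg) as (C & T' & HC).
  { intros x y Hx. destruct (Hat x y ltac:(lra)) as (H1 & H2 & _). lra. }
  { intros x y Hx. assert (H1 := SU x y ltac:(lra)). assert (H2 := SV x y ltac:(lra)). lra. }
  { intros x y Hx. rewrite !log_polar_periodic. reflexivity. }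
  { lra. }
  { intros x y Hx Hy.
    assert (H1 := SU x y ltac:(lra)). assert (H2 := SV x y ltac:(lra)).
    destruct (Hat x y ltac:(lra)) as (P1 & P2 & H3 & H4).
    assert (H5 := Bf _ (Lv x y ltac:(lra) Hy)). assert (H6 := Bg _ (Lu x y ltac:(lra) Hy)).
    set (a := log_polar u x y) in *. set (b := log_polar v x y) in *.
    assert (E1 : exp (Kf * b) <= exp ((Kf + Kg) * (a + b))) by (apply Rlt_le, exp_increasing; nra).
    assert (E2 : exp (Kg * a) <= exp ((Kf + Kg) * (a + b))) by (apply Rlt_le, exp_increasing; nra).
    nra. }
  set (T2 := Rmax (Rmax T' (T + 1)) 1).
  assert (HT2 : T' <= T2 /\ T + 1 <= T2 /\ 1 <= T2).
  { assert (H1 := Rmax_l (Rmax T' (T + 1)) 1). assert (H2 := Rmax_r (Rmax T' (T + 1)) 1).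
    assert (H3 := Rmax_l T' (T + 1)). assert (H4 := Rmax_r T' (T + 1)). unfold T2. lra. }
  assert (He : 0 < exp (- T2) / 2) by (apply Rdiv_lt_0_compat; [apply exp_pos|lra]).
  assert (Hfin : forall z : R * R, ball (0, 0) (mkposreal _ He) z -> z <> (0, 0) ->
     Rabs (u (fst z) (snd z)) <= C * Rabs (ln (1 / euclidean_norm z)) /\
     Rabs (v (fst z) (snd z)) <= C * Rabs (ln (1 / euclidean_norm z))).
  { intros [a b] [Ha Hb] Hab. simpl in *.
    change (Rabs (minus a 0) < exp (- T2) / 2) in Ha. change (Rabs (minus b 0) < exp (- T2) / 2) in Hb.
    replace (minus a 0) with a in Ha by (unfold minus, plus, opp; simpl; ring).
    replace (minus b 0) with b in Hb by (unfold minus, plus, opp; simpl; ring).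
    destruct (log_polar_surjective a b Hab) as (th & Hth & Ea & Eb).
    set (t := ln (1 / euclidean_norm (a, b))) in *.
    assert (Ht : T2 <= t).
    { apply Rnot_lt_le. intros Hlt.
      assert (Hs := plane_sqr t th). rewrite <- Ea, <- Eb in Hs.
      assert (exp (- T2) * exp (- T2) < exp (- (2 * t))).
      { rewrite <- exp_plus. apply exp_increasing. lra. }
      apply Rabs_def2 in Ha. apply Rabs_def2 in Hb. nra. }
    destruct (Hat t th ltac:(lra)) as (P1 & P2 & _).
    assert (H := HC t th ltac:(lra) Hth). unfold log_polar in *.
    rewrite <- Ea, <- Eb in *. rewrite !Rabs_pos_eq by lra. lra. }
  split; exists C; exists (mkposreal _ He); intros z Hz Hz0; apply Hfin; assumption.
Qed.
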